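(* Let $(\Omega,\leq)$ be a totally ordered set on which $\mathrm{Aut}(\Omega,\leq)$ acts transitively. If the groups $\mathrm{Aut}(\Omega,\leq)$ and $\mathrm{Aut}(\mathbb{Q},\leq)$ satisfy the same first-order sentences in the language of groups, then $\Omega$ is isomorphic as an ordered set to $\mathbb{Q}$ or to $\mathbb{R}\setminus\mathbb{Q}$.
   Context: For a totally ordered set $(\Omega,\leq)$, $\mathrm{Aut}(\Omega,\leq)$ denotes the group (under composition) of all order-preserving bijections $\Omega\to\Omega$. It acts transitively on $\Omega$ if for all $\alpha,\beta\in\Omega$ there is $g\in \mathrm{Aut}(\Omega,\leq)$ mapping $\alpha$ to $\beta$. $\mathbb{Q}$ and $\mathbb{R}\setminus\mathbb{Q}$ carry the usual order inherited from $\mathbb{R}$. *)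

(* Defs.v *)
From HB Require Import structures.
From mathcomp Require Import all_boot all_order all_algebra.
From mathcomp Require Import boolp classical_sets reals.

Set Implicit Arguments.
Unset Strict Implicit.
Unset Printing Implicit Defensive.

Import Order.TTheory.

Local Open Scope order_scope.

(* The inverse is carried as data; by funext and proof irrelevance it does not
   affect equality of automorphisms, see [oaut_eq]. *)
Record oaut (d : Order.disp_t) (T : orderType d) := OAut {
  oaut_fun :> T -> T;
  oaut_inv : T -> T;
  oaut_funK : cancel oaut_fun oaut_inv;
  oaut_invK : cancel oaut_inv oaut_fun;
  oaut_homo : {homo oaut_fun : x y / x <= y}
}.

Section AutGroup.
Context {d : Order.disp_t} (T : orderType d).
Implicit Types f g h : oaut T.

Lemma oaut_eq f g : oaut_fun f =1 oaut_fun g -> f = g.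
Proof.
case: f g => [f f' fK f'K fh] [g g' gK g'K gh] /= fg.
have {}fg : f = g by apply/funext.
subst g.
have f'g' : f' = g' by apply/funext => x; rewrite -{1}(g'K x) fK.
subst g'.
by congr OAut; apply: Prop_irrelevance.
Qed.

Lemma oaut_bij f : bijective f.
Proof. by exists (oaut_inv f); [exact: oaut_funK|exact: oaut_invK]. Qed.

Lemma oaut_of_bij (f : T -> T) :
  bijective f -> {homo f : x y / x <= y} -> exists g : oaut T, oaut_fun g = f.
Proof. by move=> [f' fK f'K] fh; exists (OAut fK f'K fh). Qed.

Definition oaut_id : oaut T :=
  @OAut d T id id (frefl id) (frefl id) (fun _ _ => id).

Lemma oaut_inv_homo f : {homo oaut_inv f : x y / x <= y}.
Proof.
move=> x y xy; have [//|yx] := leP (oaut_inv f x) (oaut_inv f y).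
have /(@oaut_homo _ _ f) := ltW yx; rewrite !oaut_invK => yx'.
suff e : x = y by rewrite e ltxx in yx.
by apply: le_anti; rewrite xy yx'.
Qed.

Definition oaut_inverse f : oaut T :=
  OAut (@oaut_invK _ _ f) (@oaut_funK _ _ f) (@oaut_inv_homo f).

Definition oaut_comp f g : oaut T :=
  OAut (can_comp (@oaut_funK _ _ f) (@oaut_funK _ _ g))
       (can_comp (@oaut_invK _ _ g) (@oaut_invK _ _ f))
       (fun x y xy => @oaut_homo _ _ f _ _ (@oaut_homo _ _ g _ _ xy)).

HB.instance Definition _ := gen_eqMixin (oaut T).
HB.instance Definition _ := gen_choiceMixin (oaut T).

Lemma oaut_compA : associative oaut_comp.
Proof. by move=> f g h; apply: oaut_eq. Qed.

Lemma oaut_comp1f : left_id oaut_id oaut_comp.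
Proof. by move=> f; apply: oaut_eq. Qed.

Lemma oaut_compf1 : right_id oaut_id oaut_comp.
Proof. by move=> f; apply: oaut_eq. Qed.

Lemma oaut_compVf : left_inverse oaut_id oaut_inverse oaut_comp.
Proof. by move=> f; apply: oaut_eq => x; exact: oaut_funK. Qed.

Lemma oaut_compfV : right_inverse oaut_id oaut_inverse oaut_comp.
Proof. by move=> f; apply: oaut_eq => x; exact: oaut_invK. Qed.

HB.instance Definition _ := isGroup.Build (oaut T)
  oaut_compA oaut_comp1f oaut_compf1 oaut_compVf oaut_compfV.

Definition oaut_transitive : Prop := forall a b : T, exists g : oaut T, g a = b.

End AutGroup.

Inductive gterm : Type :=
| GVar of nat
| GOne
| GMul of gterm & gterm
| GInv of gterm.

Inductive gformula : Type :=
| GEq of gterm & gterm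
| GNot of gformula
| GAnd of gformula & gformula
| GOr of gformula & gformula
| GImp of gformula & gformula
| GForall of nat & gformula
| GExists of nat & gformula.

Fixpoint term_occurs (i : nat) (t : gterm) : bool :=
  match t with
  | GVar j => i == j
  | GOne => false
  | GMul t1 t2 => term_occurs i t1 || term_occurs i t2
  | GInv t1 => term_occurs i t1
  end.

Fixpoint occurs_free (i : nat) (p : gformula) : bool :=
  match p with
  | GEq t1 t2 => term_occurs i t1 || term_occurs i t2
  | GNot p1 => occurs_free i p1
  | GAnd p1 p2 | GOr p1 p2 | GImp p1 p2 => occurs_free i p1 || occurs_free i p2
  | GForall j p1 | GExists j p1 => (i != j) && occurs_free i p1
  end.

Definition gsentence (p : gformula) : Prop := forall i, ~~ occurs_free i p.

Section Satisfaction.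
Variable G : groupType.

Definition env_upd (e : nat -> G) (i : nat) (x : G) : nat -> G :=
  fun j => if j == i then x else e j.

Fixpoint geval (e : nat -> G) (t : gterm) : G :=
  match t with
  | GVar i => e i
  | GOne => 1%g
  | GMul t1 t2 => (geval e t1 * geval e t2)%g
  | GInv t1 => ((geval e t1)^-1)%g
  end.

Fixpoint gholds (e : nat -> G) (p : gformula) : Prop :=
  match p with
  | GEq t1 t2 => geval e t1 = geval e t2
  | GNot p1 => ~ gholds e p1
  | GAnd p1 p2 => gholds e p1 /\ gholds e p2
  | GOr p1 p2 => gholds e p1 \/ gholds e p2
  | GImp p1 p2 => gholds e p1 -> gholds e p2
  | GForall i p1 => forall x : G, gholds (env_upd e i x) p1
  | GExists i p1 => exists x : G, gholds (env_upd e i x) p1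
  end.

(* The environment is irrelevant when [p] is a sentence. *)
Definition gsat (p : gformula) : Prop := gholds (fun=> 1%g) p.

End Satisfaction.

Definition elem_equiv (G H : groupType) : Prop :=
  forall p : gformula, gsentence p -> (gsat G p <-> gsat H p).

(* Monotone bijections suffice because both orders are total. *)
Definition order_isomorphic (d1 d2 : Order.disp_t)
    (T1 : orderType d1) (T2 : orderType d2) : Prop :=
  exists2 f : T1 -> T2, bijective f & {homo f : x y / x <= y}.

Definition irrationals (R : realType) : Type := set_type (@irrational R).

HB.instance Definition _ (R : realType) :=
  SubChoice.on (irrationals R).
HB.instance Definition _ (R : realType) :=
  [SubChoice_isSubOrder of irrationals R by <: with ring_display].

Lemma irrationals_leE (R : realType) (x y : irrationals R) :
  (x <= y) = (\val x <= \val y).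
Proof. by []. Qed.

(* Main.v *)
(* A single first-order sentence suffices. In a transitive
   chain T it forces Aut T to be transitive on ordered pairs: Aut T is closed under
   pointwise maxima and minima and under cutting and pasting at invariant cuts, so
   otherwise a point stabiliser fixes a proper cut beyond its point, which yields a
   convex block; the element a supported in such a block violates the clause that
   any two conjugates of a fail to commute with a common conjugate of a.
   For a transitive-on-pairs chain, a pair (n, p) whose definable group [side n p]
   has pairwise comparable conjugates determines a cut of T, whose stabiliser is
   the normaliser of that group. The orbit of a cut is countable as soon as it is
   exhausted by two bicommutants, since z in the bicommutant of f moves each cut L
   to f^i L for some i. Countability of one orbit of cuts, together with the fact
   that the automorphism group of T has at most two orbits on cuts, leaves two
   cases: the countable orbit is the set of points, and T is isomorphic to Q by
   Cantor, or the points are exactly the remaining cuts, and T is isomorphic to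
   the irrationals. *)

Require Import Defs.
From HB Require Import structures.
From mathcomp Require Import all_boot all_order all_algebra.
From mathcomp Require Import boolp classical_sets reals.

Set Implicit Arguments.
Unset Strict Implicit.
Unset Printing Implicit Defensive.

Import Order.TTheory.

Local Open Scope group_scope.
Local Open Scope order_scope.
Local Open Scope classical_set_scope.

(** Countability is not a first-order property; bicommutants make it expressible for orbits of cuts.
    The bicommutant of [f] is definable from [f], yet it acts on a cut only as the powers of [f] do.
    The images of a cut under the powers of one [f] are monotone in the exponent, so they cannot
    separate the points of the chain. Two automorphisms suffice for the rationals: in their copy,
    the dyadic numbers, each [m / 2 ^ n] comes from [0] by [m] unit translations and [n] halvings.
    The group sees cuts rather than points: a pair [(n, p)] does not reveal whether its cut lies at
    a point or at a gap, whence the two alternatives in the conclusion. Pairs are constructed only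
    for cuts with a countable cofinal sequence. A countable orbit that separates points gives every
    cut such a sequence, so the clause on orbits of pairs then speaks of all cuts. *)

Section Automorphisms.
Context {d : Order.disp_t} {T : orderType d}.
Implicit Types (f g h k : oaut T) (x y z : T) (L M : set T).

(** * Pasting, pointwise lattice operations and the action on subsets *)

Lemma autK f : cancel f f^-1. Proof. exact: oaut_funK. Qed.
Lemma autVK f : cancel f^-1 f. Proof. exact: oaut_invK. Qed.

Lemma aut_inj f : injective f. Proof. exact: can_inj (autK f). Qed.

Lemma aut_le f : {mono f : x y / x <= y}.
Proof. by apply: le_mono; apply: inj_homo_lt (@oaut_homo _ _ f); exact: aut_inj. Qed.

Lemma aut_lt f : {mono f : x y / x < y}.
Proof. by move=> x y; rewrite !ltNge aut_le. Qed.

Lemma aut_ltV f x y : (f^-1 x < y) = (x < f y).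
Proof. by rewrite -(aut_lt f) autVK. Qed.

Lemma aut_leV f x y : (f^-1 x <= y) = (x <= f y).
Proof. by rewrite -(aut_le f) autVK. Qed.

Lemma aut_fixV f x : f x = x -> f^-1 x = x.
Proof. by move=> fx; rewrite -{1}fx autK. Qed.

Lemma aut_neq1 f : f <> 1 -> exists x, f x <> x.
Proof.
move=> f1; apply: contrapT => nx; apply: f1; apply: oaut_eq => x.
by apply: contrapT => fx; apply: nx; exists x.
Qed.

Lemma aut_up f : f <> 1 -> exists x, x < f x \/ x < f^-1 x.
Proof.
move=> /aut_neq1[x fx]; exists x; case: (ltgtP x (f x)) => [|fxx|/esym//]; first by left.
by right; rewrite -(aut_lt f) autVK.
Qed.

Definition convex (V : set T) := forall x y z, V x -> V z -> x <= y -> y <= z -> V y.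

Lemma convex_lt V W x y z t : convex V -> convex W -> (forall u, V u -> W u -> False) ->
  V x -> V z -> W y -> W t -> x <= y -> z <= t.
Proof.
move=> cV cW VW Vx Vz Wy Wt xy; rewrite leNgt; apply/negP => tz.
have [yz|/ltW zy] := leP y z; first exact: (VW y (cV x y z Vx Vz xy yz) Wy).
exact: (VW z Vz (cW t z y Wt Wy (ltW tz) zy)).
Qed.

(** Every piece is convex and mapped onto itself, so points that do not lie in a common piece keep
    their relative position; monotonicity is at stake only inside one piece. *)
Lemma glue (I : Type) (V : I -> set T) (h : I -> oaut T) :
  (forall i, convex (V i)) -> (forall i j x, V i x -> V j x -> i = j) ->
  (forall i x, V i (h i x) <-> V i x) ->
  exists k, (forall i x, V i x -> k x = h i x) /\
            (forall x, (forall i, ~ V i x) -> k x = x).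
Proof.
move=> cV dV hV.
(* The family is a parameter so that the same pasting, applied to the inverses, yields the inverse
   map. *)
pose F (e : I -> T -> T) x :=
  if pselect (exists i, V i x) is left H then e (projT1 (cid H)) x else x.
have FV e i x : V i x -> F e x = e i x.
  rewrite /F; case: pselect => [H|H] Vx; last by case: H; exists i.
  by case: cid => j /= Vj; rewrite (dV _ _ _ Vj Vx).
have FN e x : (forall i, ~ V i x) -> F e x = x.
  by rewrite /F; case: pselect => // -[i Vi] /(_ i).
have hV' i x : V i ((h i)^-1 x) <-> V i x by rewrite -(hV i ((h i)^-1 x)) autVK.
pose h' i := oaut_inv (h i).
have Fx (x : T) : (exists i, V i x) \/ (forall i, ~ V i x).
  by case: (pselect (exists i, V i x)) => [|/forallNP]; [left|right].
have K1 : cancel (F h) (F h').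
  move=> x; case: (Fx x) => [[i Vi]|n]; last by rewrite !FN // FN.
  by rewrite (FV h i) // (FV _ i) ?hV //; exact: autK.
have K2 : cancel (F h') (F h).
  move=> x; case: (Fx x) => [[i Vi]|n]; last by rewrite !FN // FN.
  by rewrite (FV h' i) // (FV h i) ?hV' //; exact: autVK.
have hom : {homo F h : x y / x <= y}.
  move=> x y xy.
  case: (Fx x) => [[i Vx]|nx]; case: (Fx y) => [[j Vy]|ny].
  - case: (pselect (V j x)) => [Vjx|Vjx]; first by rewrite !(FV _ j) // aut_le.
    rewrite (FV _ _ _ Vx) (FV _ _ _ Vy).
    apply: (convex_lt (V := V i) (W := V j) (x := x) (y := y)) => //; try exact/hV.
    by move=> u Vu Wu; apply: Vjx; rewrite (dV _ _ _ Wu Vu).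
  - rewrite (FV _ _ _ Vx) (FN _ _ ny) leNgt; apply/negP => yh.
    by apply: (ny i); apply: (cV i x y (h i x)) => //; [exact/hV|exact: ltW].
  - rewrite (FV _ _ _ Vy) (FN _ _ nx) leNgt; apply/negP => yh.
    by apply: (nx j); apply: (cV j (h j y) x y) => //; [exact/hV|exact: ltW].
  - by rewrite !FN.
have [k kF] := oaut_of_bij (Bijective K1 K2) hom.
by exists k; rewrite kF; split=> *; [exact: FV|exact: FN].
Qed.

Lemma restrict (V : set T) h : convex V -> (forall x, V (h x) <-> V x) ->
  exists k, (forall x, V x -> k x = h x) /\ (forall x, ~ V x -> k x = x).
Proof.
move=> cV hV.
have [//|i j x _ _|//|k [k1 k2]] := @glue unit (fun=> V) (fun=> h); first by case: i; case: j.
by exists k; split=> x Vx; [exact: (k1 tt)|exact: k2].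
Qed.

Lemma aut_join f g : exists h, forall x, h x = Order.max (f x) (g x).
Proof.
pose F x := Order.max (f x) (g x); pose F' x := Order.min (f^-1 x) (g^-1 x).
have K1 : cancel F F'.
  move=> x; rewrite /F /F'; case: (leP (f x) (g x)) => fg.
    by rewrite autK min_r // -(aut_le f) autVK.
  by rewrite autK min_l // -(aut_le g) autVK ltW.
have K2 : cancel F' F.
  move=> x; rewrite /F /F'; case: (leP (f^-1 x) (g^-1 x)) => fg.
    by rewrite autVK max_l // -(aut_le g^-1) autK.
  by rewrite autVK max_r // -(aut_le f^-1) autK ltW.
have hom : {homo F : x y / x <= y}.
  by move=> x y xy; rewrite /F ge_max !le_max !aut_le xy orbT.
by have [k kF] := oaut_of_bij (Bijective K1 K2) hom; exists k => x; rewrite kF.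
Qed.

Lemma aut_meet f g : exists h, forall x, h x = Order.min (f x) (g x).
Proof.
have [h hE] := aut_join f^-1 g^-1; exists h^-1 => x.
apply: (@aut_inj h); rewrite autVK hE; case: (leP (f x) (g x)) => fg.
  by rewrite autK max_l // -(aut_le g) autVK.
by rewrite autK max_r // -(aut_le f) autVK ltW.
Qed.

Definition act h L : set T := fun x => L (h^-1 x).

Lemma actM f g L : act (f * g) L = act f (act g L). Proof. by []. Qed.
Lemma actK f : cancel (act f) (act f^-1).
Proof. by move=> L; rewrite -actM mulVg. Qed.
Lemma actVK f : cancel (act f^-1) (act f).
Proof. by move=> L; rewrite -actM mulgV. Qed.
Lemma act_aut f L x : act f L (f x) = L x. Proof. by rewrite /act autK. Qed.
Lemma act_sub f L M : L `<=` M -> act f L `<=` act f M.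
Proof. by move=> LM x; exact: LM. Qed.
Lemma act_subE f L M : act f L `<=` act f M <-> L `<=` M.
Proof. by split=> [H|]; [rewrite -(actK f L) -(actK f M)|]; apply: act_sub. Qed.

End Automorphisms.

Section GroupProperties.
Variable G : groupType.
Implicit Types a c f g h k n p s t x y : G.

Definition cj h x := h * x * h^-1.

Definition overlapping := forall a x, a <> 1 ->
  exists y, ~ commute a (cj y a) /\ ~ commute (cj x a) (cj y a).

(** Excludes a bi-invariant total order on the group: there a nontrivial element and its inverse lie
    on opposite sides of [1], and conjugation preserves the side. *)
Definition has_reversed := exists h t, h <> 1 /\ cj t h = h^-1.

End GroupProperties.

(** * Equivariant families of sets and orbits of a point stabiliser *)

Section Transitivity.
Context {d : Order.disp_t} {T : orderType d}.
Implicit Types (f g h k : oaut T) (x y z : T) (L M : set T).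

Definition bitransitive := forall x y z t, x < y -> z < t -> exists g, g x = z /\ g y = t.

Lemma commute_disjoint f g : (forall x, f x <> x -> g x <> x -> False) -> commute f g.
Proof.
move=> fg; apply: oaut_eq => x; change (f (g x) = g (f x)).
have [fx|fx] := pselect (f x = x); have [gx|gx] := pselect (g x = x).
- by rewrite gx fx gx.
- rewrite fx; apply: contrapT => fgx; apply: (fg _ fgx) => /aut_inj ggx.
  exact: gx.
- rewrite gx; apply: contrapT => gfx; apply: (fg (f x)) => [/aut_inj//|E].
  exact: gfx.
- by case: (fg x).
Qed.

Lemma commute_fun f g x : commute f g -> f (g x) = g (f x).
Proof. by move=> /(congr1 (fun h : oaut T => h x)). Qed.

Lemma cjE h f x : cj h f x = h (f (h^-1 x)). Proof. by []. Qed.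

Section EquivariantFamily.
Variable e : T -> set T.
Hypothesis e_equiv : forall g x, e (g x) = act g (e x).
Hypothesis e_mono : forall x y, x <= y -> e x `<=` e y.

(* The fibres of [e] are convex blocks; an automorphism supported in one block
   only overlaps with its conjugates by elements preserving that block. *)
Lemma equivariant_constant x y : overlapping (oaut T) -> oaut_transitive T ->
  x < y -> e x = e y -> forall z, e z = e x.
Proof.
move=> ov tr xy exy z.
have [k kx] := tr x y; have [g gx] := tr x z.
have kB t : e (k t) = e x <-> e t = e x.
  have ek : act k (e x) = e x by rewrite -e_equiv kx -exy.
  by rewrite e_equiv -{1}ek; split=> [/(can_inj (actK k))|->].
have cB : convex [set t | e t = e x].
  move=> s t u /= es eu st tu; apply/seteqP.
  by split=> w; [rewrite -eu; apply: e_mono|rewrite -es; apply: e_mono].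
have [a [aB anB]] := restrict cB kB.
have a1 : a <> 1.
  move=> a1; have : a x = y by rewrite (aB x).
  by rewrite a1 /= => xy'; move: xy; rewrite xy' ltxx.
have supp u : a u <> u -> e u = e x.
  by move=> au; apply: contrapT => /anB.
have suppc h u : cj h a u <> u -> e u = act h (e x).
  move=> hau; have [] := pselect (a (h^-1 u) = h^-1 u).
    by move=> E; case: hau; rewrite cjE E autVK.
  by move=> /supp <-; rewrite -e_equiv autVK.
have [w [aw gw]] := ov a g a1.
have -> : e z = act w (e x).
  rewrite -gx e_equiv; apply: contrapT => neq; apply: gw; apply: commute_disjoint => u.
  by move=> /suppc E1 /suppc E2; apply: neq; rewrite -E1.
apply: contrapT => neq; apply: aw; apply: commute_disjoint => u.
by move=> /supp E1 /suppc E2; apply: neq; rewrite -E2.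
Qed.

End EquivariantFamily.

Section Orbits.
Variables (a b : T).
Hypothesis ab : a < b.

(** For [x = a] this is the downward closure of the orbit of [b] under the stabiliser of [a];
    letting [x] vary makes it an equivariant family. *)
Definition orb x : set T := fun y => exists2 k : oaut T, k a = x & y <= k b.

Lemma orb_equiv g x : orb (g x) = act g (orb x).
Proof.
apply/seteqP; split=> y [k kx yk].
  by exists (g^-1 * k); [change (g^-1 (k a) = x); rewrite kx autK|rewrite aut_leV [g _]autVK].
exists (g * k); first by change (g (k a) = g x); rewrite kx.
by move: yk; rewrite aut_leV.
Qed.

Lemma orb_mono : oaut_transitive T -> forall x y, x <= y -> orb x `<=` orb y.
Proof.
move=> tr x y xy z [k kx zk]; have [h hy] := tr a y.
have [j jE] := aut_join k h; exists j; first by rewrite jE kx hy max_r.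
by rewrite jE le_max zk.
Qed.

Lemma orb_down x y z : orb x z -> y <= z -> orb x y.
Proof. by move=> [k kx zk] yz; exists k => //; exact: le_trans zk. Qed.

Lemma orb_gt x : oaut_transitive T -> exists2 y, x < y & orb x y.
Proof.
move=> tr; have [k kx] := tr a x; exists (k b); first by rewrite -kx aut_lt.
by exists k.
Qed.

Lemma orb_refl x : oaut_transitive T -> orb x x.
Proof. by move=> tr; have [y xy /orb_down] := orb_gt x tr; apply; exact: ltW. Qed.

(* Convexity of the orbits of the stabiliser of [a]; if [k b = c], the witness is
   [max id (min g k)]. *)
Lemma orb_full c : oaut_transitive T -> b <= c -> orb a c -> exists2 g : oaut T, g a = a & g b = c.
Proof.
move=> tr bc [g ga cg]; have [k kb] := tr b c.
have [m mE] := aut_meet g k; have [j jE] := aut_join 1 m.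
exists j; rewrite jE mE.
  by rewrite ga max_l // ge_min lexx.
by rewrite kb min_r // max_r.
Qed.

End Orbits.
End Transitivity.

(** * Equivariant families that separate points *)

Section InjectiveEquivariantFamily.
Context {d : Order.disp_t} {T : orderType d}.
Implicit Types (f g h k : oaut T) (x y z : T) (L M : set T).

Definition lower L := forall x y, L y -> x <= y -> L x.

Lemma act_lower g L : lower L -> lower (act g L).
Proof. by move=> Ll x y Ly xy; apply: (Ll _ _ Ly); rewrite aut_le. Qed.

Variable e : T -> set T.
Hypothesis e_equiv : forall g x, e (g x) = act g (e x).
Hypothesis e_mono : forall x y, x <= y -> e x `<=` e y.
Hypothesis e_lower : forall x, lower (e x).
Hypothesis e_gt : forall x, exists2 y, x < y & e x y.
Hypothesis e_inj : injective e.

Definition e_closed L := lower L /\ forall x, L x -> e x `<=` L.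

Definition e_hull x : set T := fun y => forall L, e_closed L -> L x -> L y.

Lemma act_closed g L : e_closed L -> e_closed (act g L).
Proof.
move=> [Ll Le]; split; first exact: act_lower.
by move=> x Lx y exy; apply: (Le _ Lx); rewrite e_equiv /act invgK autVK.
Qed.

Lemma e_hull_equiv g x : e_hull (g x) = act g (e_hull x).
Proof.
apply/seteqP; split=> y H L cL Lx.
  by have := H _ (act_closed g cL); rewrite /act autK; apply.
by have := H _ (act_closed g^-1 cL); rewrite /act invgK autVK; apply.
Qed.

(** A point [z] of [e x] above [x] has the same hull as [x]. The hulls thus form an equivariant
    monotone family taking one value twice; such a family is constant, and each point lies in its
    own hull. *)
Lemma e_hull_full : overlapping (oaut T) -> oaut_transitive T -> forall x y, e_hull x y.
Proof.
move=> ov tr x y; have [z xz exz] := e_gt x.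
have hm s t : s <= t -> e_hull s `<=` e_hull t.
  by move=> st w H L cL Lt; apply: H => //; case: cL => Ll _; exact: Ll Lt st.
have hxz : e_hull x = e_hull z.
  apply/seteqP; split; first by apply: hm; exact: ltW.
  by move=> w H L cL Lx; apply: H => //; case: cL => _ /(_ _ Lx); apply.
rewrite -(equivariant_constant e_hull_equiv hm ov tr xz hxz y).
by move=> L _.
Qed.

(* Cutting an automorphism at invariant cuts does not change [e] at the point
   considered, so injectivity of [e] forces that point to be fixed. *)
Lemma fix_above g x y : g x = x -> x < y -> e x y -> g y = y.
Proof.
move=> gx xy exy.
have [V hV] : exists V, V = [set w | x < w /\ e x w] by eexists.
have gV w : V (g w) <-> V w.
  by rewrite hV /= -{1 2}gx e_equiv act_aut aut_lt.
have cV : convex V.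
  rewrite hV => s t u [xs _] [_ eu] st tu; split; first exact: lt_le_trans st.
  exact: e_lower tu.
have [k [kV kN]] := restrict cV gV.
have VE w : V w -> e y w by rewrite hV => -[_]; apply: e_mono; exact: ltW.
have ek : act k (e y) = e y.
  suff H w : e y w -> e y (k w).
    have kVV w : V (k w) <-> V w.
      have [Vw|Vw] := pselect (V w); first by rewrite kV.
      by rewrite kN.
    apply/seteqP; split=> w ew.
      by have := H _ ew; rewrite autVK.
    change (e y (k^-1 w)); have [Vw|Vw] := pselect (V w).
      by apply: VE; rewrite -kVV autVK.
    by rewrite (aut_fixV (kN _ Vw)).
  move=> ew; have [Vw|Vw] := pselect (V w); last by rewrite kN.
  by rewrite kV //; apply: VE; rewrite gV.
have Vy : V y by rewrite hV.
by rewrite -(kV _ Vy); apply: e_inj; rewrite e_equiv.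
Qed.

(** Restricting [g] to the points below [x] leaves [e y] invariant: these points all belong to
    [e y], and elsewhere the restriction is the identity. Injectivity of [e] then fixes [y]. *)
Lemma fix_below g x y : g x = x -> y < x -> e y x -> g y = y.
Proof.
move=> gx yx eyx.
have cV : convex [set w | w < x] by move=> s t u /= _ ux _ /le_lt_trans; apply.
have gV w : [set w | w < x] (g w) <-> [set w | w < x] w by rewrite /= -{1}gx aut_lt.
have [k [kV kN]] := restrict cV gV.
have kx w : (k w < x) = (w < x).
  by rewrite -{1}(kN x) ?aut_lt //= ltxx.
rewrite -(kV y yx); apply: e_inj; rewrite e_equiv.
apply/seteqP; split=> w; rewrite /act; have [wx|xw] := ltP w x.
- by move=> _; apply: e_lower eyx _; exact: ltW.
- by rewrite aut_fixV // kN //=; apply/negP; rewrite -leNgt.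
- by move=> _; apply: e_lower eyx _; rewrite ltW // -kx autVK.
- by rewrite aut_fixV // kN //=; apply/negP; rewrite -leNgt.
Qed.

(** By [fix_above], the points up to which [g] is the identity from [x] on form a closed set, and a
    closed nonempty set is everything. By [fix_below], a moved point would make the moved points
    cofinal, although none lies above [x]. *)
Lemma free_action : overlapping (oaut T) -> oaut_transitive T ->
  forall g x, g x = x -> g = 1.
Proof.
move=> ov tr g x gx.
have fix_ge y : x <= y -> g y = y.
  pose L : set T := fun y => forall z, x <= z -> z <= y -> g z = z.
  have cL : e_closed L.
    split=> [s t Lt st z xz zs|s Ls w ews z xz zw]; first by apply: Lt => //; exact: le_trans st.
    have [sx|xs] := ltP s x; first last.
      have [/Ls->//|sz] := leP z s.
      apply: (fix_above (x := s)) => //; first exact: Ls.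
      exact: e_lower zw.
    have := xz; rewrite le_eqVlt => /orP[/eqP<-//|xz'].
    apply: (fix_above (x := x)) => //; apply: (e_mono (ltW sx)); exact: e_lower zw.
  move=> xy; apply: (@e_hull_full ov tr x y L) => //.
  by move=> z xz zx; have -> : z = x by apply/eqP; rewrite eq_le xz zx.
apply: oaut_eq => y; change (g y = y); apply: contrapT => gy.
pose L : set T := fun z => exists2 t, z <= t & g t <> t.
have cL : e_closed L.
  split=> [s t [u tu gu] st|z [t zt gt] w ezw]; first by exists u => //; exact: le_trans tu.
  have etw := e_mono zt ezw.
  apply: contrapT => Lw; have gw u : w <= u -> g u = u.
    by move=> wu; apply: contrapT => gu; apply: Lw; exists u.
  have [/gw//|tw] := leP w t.
  by apply: gt; apply: (fix_below (x := w)) => //; exact: gw.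
have [|z xz] := @e_hull_full ov tr y x L cL; first by exists y.
by apply; exact: fix_ge.
Qed.

End InjectiveEquivariantFamily.

(** * Transitivity on ordered pairs *)

Section Bitransitivity.
Context {d : Order.disp_t} {T : orderType d}.
Implicit Types (f g h k : oaut T) (x y z : T).

(* If point stabilisers were trivial, the pointwise order on automorphisms would
   be total and conjugation-invariant. *)
Lemma not_free : has_reversed (oaut T) -> ~ forall g x, g x = x -> g = 1.
Proof.
move=> [h [t [h1 tht]]] free.
have total k x : x < k x -> forall y, y <= k y.
  move=> xk y; have [m mE] := aut_join k 1.
  (* [k] and its join with the identity agree at [x], so freeness makes them equal. *)
  have -> : k = m.
    rewrite -[k]mulg1 -(mulVg m) mulgA (free (k * m^-1) (m x)) ?mul1g //.
    change (k (m^-1 (m x)) = m x).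
    by rewrite autK mE max_l // ltW.
  by rewrite mE le_max lexx orbT.
have no k x : cj t k = k^-1 -> x < k x -> False.
  move=> tk xk; have := total k x xk (k^-1 (t x)).
  by rewrite autVK -tk cjE autK aut_le leNgt xk.
have [x [|]] := aut_up h1; first exact: no.
by apply: no; rewrite -{2}tht /cj !invgM invgK mulgA.
Qed.

(** If the stabiliser of [a] cannot move [b] to [c], the family [orb a b] is not constant, because
    [orb a b c] contains [c]. It therefore separates points, the action is free, and [not_free]
    excludes that. *)
Lemma bitransitiveP : oaut_transitive T -> overlapping (oaut T) -> has_reversed (oaut T) ->
  @bitransitive d T.
Proof.
move=> tr ov rev.
suff H a b c : a < b -> b <= c -> exists2 g : oaut T, g a = a & g b = c.
  move=> x y z t xy zt; have [k kx] := tr x z.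
  have zky : z < k y by rewrite -kx aut_lt.
  (* [H] only moves points upwards, so one of the two cases uses an inverse. *)
  have [tky|kyt] := leP t (k y).
    have [g gz gt] := H _ _ _ zt tky; exists (g^-1 * k); split.
      by change (g^-1 (k x) = z); rewrite kx -{1}gz autK.
    by change (g^-1 (k y) = t); rewrite -gt autK.
  have [g gz gt] := H _ _ _ zky (ltW kyt); exists (g * k); split=> //.
  by change (g (k x) = z); rewrite kx.
move=> ab bc; apply: orb_full => //; apply: contrapT => nc.
have eq := @orb_equiv _ T a b; have mono := @orb_mono _ T a b tr.
have inj : injective (orb a b).
  move=> x y; wlog xy : x y / x < y => [hw|].
    by case: (ltgtP x y) => // [/hw//|yx /esym/hw ->].
  move=> exy; have cst := equivariant_constant eq mono ov tr xy exy.
  by case: nc; rewrite (cst a) -(cst c); exact: orb_refl.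
apply: (not_free rev); apply: (free_action (e := orb a b)) => //.
- by move=> x s t; exact: orb_down.
- by move=> x; exact: orb_gt.
Qed.

End Bitransitivity.

(** * Local automorphisms and cuts of a doubly homogeneous chain *)

Section DoublyHomogeneous.
Context {d : Order.disp_t} {T : orderType d}.
Implicit Types (f g h k s : oaut T) (x y z t u v : T) (L M : set T).

Definition doubly_homogeneous :=
  [/\ oaut_transitive T, bitransitive (T := T) & exists x y : T, x < y].

Hypothesis dhT : doubly_homogeneous.

Lemma dh_gt x : exists y, x < y.
Proof.
have [tr _ [a [b ab]]] := dhT; have [g <-] := tr a x.
by exists (g b); rewrite aut_lt.
Qed.

Lemma dh_lt x : exists y, y < x.
Proof.
have [tr _ [a [b ab]]] := dhT; have [g <-] := tr b x.
by exists (g a); rewrite aut_lt.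
Qed.

Lemma dh_dense x y : x < y -> exists2 z, x < z & z < y.
Proof.
move=> xy; have [z yz] := dh_gt y; have [_ bt _] := dhT.
have [g [gx gz]] := bt x z x y (lt_trans xy yz) xy.
by exists (g y); [rewrite -{1}gx aut_lt|rewrite -{2}gz aut_lt].
Qed.

Lemma shift_above t x y : t < x -> t < y ->
  exists2 g : oaut T, (forall z, z <= t -> g z = z) & g x = y.
Proof.
move=> tx ty; have [_ bt _] := dhT; have [g [gt gx]] := bt t x t y tx ty.
have [|z|k [k1 k2]] := @restrict _ _ [set z | t < z] g.
- by move=> u v w /= tu _ uv _; exact: lt_le_trans uv.
- by rewrite /= -{1}gt aut_lt.
- exists k; last by rewrite k1.
  by move=> z zt; rewrite k2 //=; apply/negP; rewrite -leNgt.
Qed.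

(** Once the first point is in place, the rest is corrected by an automorphism that fixes everything
    up to its new position. *)
Lemma shift_seq t (xs ys : seq T) : path <%O t xs -> path <%O t ys -> size xs = size ys ->
  exists2 g : oaut T, (forall z, z <= t -> g z = z) & map g xs = ys.
Proof.
elim: ys xs t => [|y ys IH] [|x xs] t //=; first by exists 1.
move=> /andP[tx xxs] /andP[ty yys] [sz]; have [g g1 gx] := shift_above tx ty.
have pxs : path <%O y (map g xs) by rewrite -gx (mono_path (aut_lt g)).
have [|k k1 kxs] := IH (map g xs) y pxs yys; first by rewrite size_map.
exists (k * g) => [z zt|].
  by change (k (g z) = z); rewrite g1 // k1 // ltW // (le_lt_trans zt).
rewrite -kxs -map_comp; congr (_ :: _).
by change (k (g x) = y); rewrite gx k1.
Qed.

(** An automorphism fixing [x] and [y] preserves the interval between them, so it can be replaced by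
    the identity outside. *)
Lemma local_shift x u v y : x < u -> u < y -> x < v -> v < y ->
  exists2 h : oaut T, h u = v & forall z, ~~ ((x < z) && (z < y)) -> h z = z.
Proof.
move=> xu uy xv vy.
have [||//|g g1 [gu gy]] := @shift_seq x [:: u; y] [:: v; y]; rewrite /= ?xu ?xv ?uy ?vy //.
have [|z|k [k1 k2]] := @restrict _ _ [set z | (x < z) && (z < y)] g.
- move=> r s t /= /andP[xr _] /andP[_ ty] rs st.
  by rewrite (lt_le_trans xr rs) (le_lt_trans st ty).
- by rewrite /= -{1}(g1 x (lexx x)) -{1}gy !aut_lt.
- exists k; first by rewrite k1 //= xu uy.
  by move=> z /negP nz; rewrite k2.
Qed.

Lemma local_nontrivial x y : x < y -> exists h : oaut T, exists2 u, h u <> u &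
  x < u /\ u < y /\ forall z, h z <> z -> x < z /\ z < y.
Proof.
move=> xy; have [v xv vy] := dh_dense xy; have [u xu uv] := dh_dense xv.
have [h hu hz] := local_shift xu (lt_trans uv vy) xv vy.
exists h, u; first by rewrite hu => vu; move: uv; rewrite vu ltxx.
split=> //; split=> [|z]; first exact: lt_trans vy.
move=> hzz; have [/andP[]//|nz] := boolP ((x < z) && (z < y)).
by case: hzz; exact: hz.
Qed.

(** Forbidding a greatest element attaches exactly one cut to each point, the set of points strictly
    below it. *)
Definition cut L := [/\ lower L, exists x, L x, exists x, ~ L x &
  forall x, L x -> exists2 y, L y & x < y].

Lemma act_cut g L : cut L -> cut (act g L).
Proof.
move=> [Ll [x Lx] [y Ly] Lm]; split; first exact: act_lower.
- by exists (g x); rewrite act_aut.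
- by exists (g y); rewrite act_aut.
- move=> z Lz; have [t Lt zt] := Lm _ Lz; exists (g t); first by rewrite act_aut.
  by rewrite -(aut_lt g^-1) autK.
Qed.

Lemma principal_cut x : cut [set y | y < x].
Proof.
split=> [y z /= zx yz||| y /= yx]; first exact: le_lt_trans zx.
- exact: dh_lt.
- by exists x; rewrite /= ltxx.
- by have [z yz zx] := dh_dense yx; exists z.
Qed.

Lemma act_principal g x : act g [set y | y < x] = [set y | y < g x].
Proof. by apply/seteqP; split=> y; rewrite /act /= aut_ltV. Qed.

Lemma lower_total L M : lower L -> lower M -> L `<=` M \/ M `<=` L.
Proof.
move=> Ll Ml; have [|/existsNP[x /not_implyP[Lx Mx]]] := pselect (L `<=` M); first by left.
right=> y My; have [/ltW yx|xy] := ltP y x; first exact: Ll Lx yx.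
by case: Mx; exact: Ml xy.
Qed.

Lemma lower_lt L x y : lower L -> L x -> ~ L y -> x < y.
Proof. by move=> Ll Lx Ly; rewrite ltNge; apply/negP => yx; apply: Ly; exact: Ll yx. Qed.

Lemma not_sub L M : ~ L `<=` M -> exists2 x, L x & ~ M x.
Proof. by move=> /existsNP[x /not_implyP[Lx Mx]]; exists x. Qed.

Lemma cut_gap L M : cut L -> cut M -> ~ M `<=` L ->
  exists x y, [/\ M x, M y, ~ L x, ~ L y & x < y].
Proof.
move=> [Ll _ _ _] [_ _ _ Mm] /not_sub[x Mx Lx]; have [y My xy] := Mm _ Mx.
by exists x, y; split=> // Ly; apply: Lx; apply: Ll Ly (ltW xy).
Qed.

(** If [M] reached beyond [L], a bump ending inside [M] could carry a point of [L] out of [L]; it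
    would stabilise [M] but not [L]. *)
Lemma stab_cut_sub L M : cut L -> cut M ->
  (forall g, act g M = M -> act g L = L) -> M `<=` L.
Proof.
move=> cL cM st; apply: contrapT => nML.
have [x [y [Mx My Lx Ly xy]]] := cut_gap cL cM nML.
have [Ll [u Lu] _ _] := cL; have [v vu] := dh_lt u.
have ux := lower_lt Ll Lu Lx.
have [h hu hz] := local_shift vu (lt_trans ux xy) (lt_trans vu ux) xy.
apply: Lx; rewrite -(st h) ?hu -?hu ?act_aut //.
have [Ml _ _ _] := cM.
have hM z : M z -> M (h z).
  have [zy|yz] := ltP z y.
    by move=> _; apply: Ml My _; rewrite -(hz y) ?ltxx ?andbF // aut_le ltW.
  by move=> Mz; rewrite hz // [z < y]ltNge yz andbF.
apply/seteqP; split=> z Mz; first by have := hM _ Mz; rewrite autVK.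
change (M (h^-1 z)); have [zy|yz] := ltP z y.
  apply: Ml My _; rewrite aut_leV hz ?ltxx ?andbF //; exact: ltW.
by rewrite aut_fixV // hz // [z < y]ltNge yz andbF.
Qed.

Lemma stab_cut_inj L M : cut L -> cut M ->
  (forall g, act g L = L <-> act g M = M) -> L = M.
Proof.
by move=> cL cM H; apply/seteqP; split; apply: stab_cut_sub => // g /H.
Qed.

End DoublyHomogeneous.

(** * Half lines: from a cut to a pair of group elements *)

Section HalfLines.
Variable G : groupType.
Implicit Types h k n p x : G.

(* If [n] and [p] have supports cofinal in, respectively contained in, the two
   sides of a cut, this is the group of automorphisms supported on [n]'s side. *)
Definition side n p x := forall k, commute k n -> commute x (cj k p).

Definition side_stab n p h := forall x, side n p x <-> side n p (cj h x).

Definition half_line n p := (exists x, x <> 1 /\ side n p x) /\ p <> 1 /\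
  forall h, (forall x, side n p x -> side n p (cj h x)) \/
            (forall x, side n p (cj h x) -> side n p x).

Lemma sideV n p x : side n p x -> side n p x^-1.
Proof. by move=> xA k /xA/commute_sym/commuteV/commute_sym. Qed.

Lemma cjV h x : cj h x^-1 = (cj h x)^-1.
Proof. by rewrite /cj !invgM invgK mulgA. Qed.

Lemma cjK h x : cj h (cj h^-1 x) = x.
Proof. by rewrite /cj invgK !mulgA mulgV mul1g -mulgA mulgV mulg1. Qed.

End HalfLines.

Section CutHalfLine.
Context {d : Order.disp_t} {T : orderType d}.
Implicit Types (f g h k n p s : oaut T) (x y z t u v : T) (L M : set T).
Hypothesis dhT : doubly_homogeneous (T := T).

Lemma commute_supp f g x : commute f g -> f (g x) = g x <-> f x = x.
Proof.
by move=> fg; rewrite (commute_fun _ fg); split=> [/aut_inj|->].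
Qed.

(** An element commuting with [n] permutes the points moved by [n], and these are cofinal in [L]. *)
Lemma commute_cofinal L n k : lower L -> (forall x, n x <> x -> L x) ->
  (forall x, L x -> exists2 y, x <= y & n y <> y) -> commute k n -> act k L = L.
Proof.
move=> Ll nL Ln.
suff H g : commute g n -> forall x, L x -> L (g x).
  move=> kn; apply/seteqP; split=> x Lx; first by rewrite -(autVK k x); exact: H.
  by apply: (H k^-1) => //; exact/commute_sym/commuteV/commute_sym.
move=> gn x /Ln[y xy ny]; apply: (Ll _ (g y)); last by rewrite aut_le.
by apply: nL; rewrite commute_supp //; exact: commute_sym.
Qed.

Section HalfOfCut.
Variables (L : set T) (n p : oaut T).
Hypotheses (cL : cut L) (nL : forall x, n x <> x -> L x)
  (Ln : forall x, L x -> exists2 y, x <= y & n y <> y)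
  (p1 : p <> 1) (pL : forall x, p x <> x -> ~ L x).

(** Elements commuting with [n] preserve [L], so they conjugate [p] to elements still supported off
    [L]. Conversely, if [x] moves a point off [L], there is room off [L] for a conjugator that fixes
    the support of [n] and takes [p] to an element not commuting with [x]. *)
Lemma side_cutP (x : oaut T) : side n p x <-> forall z, ~ L z -> x z = z.
Proof.
have [Ll _ _ _] := cL; split=> [xA b Lb|xL k kn]; last first.
  have kL := commute_cofinal Ll nL Ln kn.
  apply: commute_disjoint => z xz kpz.
  have pz : p (k^-1 z) <> k^-1 z by move=> E; apply: kpz; rewrite cjE E autVK.
  by apply: (pL pz); change (act k L z); rewrite kL; apply: contrapT => /xL.
apply: contrapT => xb.
wlog bx : x xA xb / b < x b => [hw|].
  have [/hw||E] := ltgtP b (x b); [exact| |by rewrite -E in xb].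
  move=> xbb; apply: (hw x^-1); first exact: sideV.
    by move=> E; apply: xb; rewrite -{1}E autVK.
  by rewrite -(aut_lt x) autVK.
have [c bc cx] := dh_dense dhT bx.
have cxc : c < x c by apply: (lt_trans cx); rewrite aut_lt.
have [q qA [a aq qL]] : exists2 q, (forall k, commute k n -> commute x (cj k q)) &
    exists2 a, a < q a & ~ L a.
  have [a [ap|ap]] := aut_up p1.
    by exists p => //; exists a => //; apply: pL => E; rewrite E ltxx in ap.
  exists p^-1; first by move=> k kn; rewrite cjV; exact/commuteV/xA.
  by exists a => //; apply: pL => /aut_fixV E; rewrite E ltxx in ap.
(* [t] bounds from below what [k] moves; starting the orbit at [q a] rather than [a] lets [t] be [a]
   itself. *)
have [t tL [tc ta]] : exists2 t, ~ L t & t < c /\ t < q a.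
  have [ba|ab] := leP b a; first by exists b => //; split=> //; exact: le_lt_trans aq.
  by exists a => //; split=> //; exact: lt_trans bc.
have [e ex ee] : exists2 e, x c < e & e <> x (x c).
  have [e1 xe1] := dh_gt dhT (x c); have [e2 e12] := dh_gt dhT e1.
  have [E|] := pselect (e1 = x (x c)); last by exists e1.
  by exists e2; [exact: lt_trans e12|rewrite -E => E2; rewrite E2 ltxx in e12].
have aa : q a < q (q a) by rewrite aut_lt.
(* The conjugate of [q] by [k] sends [c] to [x c] and [x c] to [e]; commuting with [x] would force
   [e = x (x c)]. *)
have [||//|k k1 [k2 k3 k4]] :=
  @shift_seq _ _ dhT t [:: q a; q (q a); q (q (q a))] [:: c; x c; e].
- by rewrite /= ta aa aut_lt aa.
- by rewrite /= tc cxc ex.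
have kn : commute k n.
  apply: commute_disjoint => z kz /nL Lz; apply: kz; apply: k1.
  by apply: ltW; exact: (lower_lt Ll).
have := commute_fun c (qA k kn); rewrite !cjE.
rewrite -{1}k2 autK k3 -[in X in _ = X]k3 autK k4 => E.
by apply: ee.
Qed.

(** If [h] carries a point [z] of [L] out of [L], it conjugates a bump at [z] inside [L] to an
    element moving [h z], which is no longer supported in [L]. *)
Lemma cut_side_stab h : side_stab n p h <-> act h L = L.
Proof.
have stabE (g : oaut T) : act g L = L -> forall x : oaut T, side n p x -> side n p (cj g x).
  move=> gL x /side_cutP xL; apply/side_cutP => z Lz.
  by rewrite cjE xL ?autVK // -(act_aut g) autVK gL.
split=> [st|hL x]; last first.
  split; first exact: stabE; move=> /(@stabE h^-1); rewrite -{2}(invgK h).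
  by rewrite -[in X in _ -> X](cjK h^-1 x) invgK; apply; rewrite -{1}hL actK.
have [Ll _ _ _] := cL.
have H g : side_stab n p g -> forall z, L z -> L (g z).
  move=> gst z Lz; apply: contrapT => Lgz.
  have [x xz xL] : exists2 x : oaut T, x z <> z & forall y, ~ L y -> x y = y.
    have [y Ly zy] : exists2 y, L y & z < y by case: cL => _ _ _; apply.
    have [v vz] := dh_lt dhT z; have [u zu uy] := dh_dense dhT zy.
    have [x xz xE] := local_shift dhT vz zy (lt_trans vz zu) uy.
    exists x; first by rewrite xz => E; rewrite E ltxx in zu.
    move=> w Lw; apply: xE; apply/negP => /andP[_ wy]; apply: Lw.
    by apply: Ll Ly _; exact: ltW.
  have /side_cutP/gst/side_cutP/(_ _ Lgz) := xL.
  by rewrite cjE autK => /aut_inj.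
apply/seteqP; split=> z Lz; first by rewrite -(autVK h z); exact: H.
apply: (H h^-1) => // x; rewrite (st (cj h^-1 x)) cjK; split=> // .
Qed.

Lemma cut_half_line : half_line n p.
Proof.
have [Ll [x Lx] _ Lm] := cL.
split; last split=> // h.
  have [y Ly xy] := Lm _ Lx; have [k [u ku [_ [_ kxy]]]] := local_nontrivial dhT xy.
  exists k; split; first by move=> k1; rewrite k1 in ku.
  apply/side_cutP => z Lz; apply: contrapT => /kxy[_ zy]; apply: Lz.
  by apply: Ll Ly _; exact: ltW.
have [hL|Lh] := lower_total (@act_lower _ _ h _ Ll) Ll; [left|right] => y /side_cutP yL;
  apply/side_cutP => z Lz.
  rewrite cjE yL ?autVK // => Lhz; apply: Lz; exact: hL.
have := yL (h z); rewrite cjE autK => E; apply: (@aut_inj _ _ h); apply: E => Lhz.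
by apply: Lz; have := Lh _ Lhz; rewrite act_aut.
Qed.

End HalfOfCut.
End CutHalfLine.

(** * From a half line back to a cut *)

Section HalfLineCut.
Context {d : Order.disp_t} {T : orderType d}.
Implicit Types (f g h k n p q s : oaut T) (x y z t u v : T) (L M : set T).
Hypothesis dhT : doubly_homogeneous (T := T).

(* Take [h] supported in a short interval just above [z]; the support of the
   commutator of [h] and [q] is [g]-invariant and lies above [z]. *)
Lemma commute_conj_fix g q z : commute g q ->
  (forall h, commute g (cj h q) \/ commute g (cj h^-1 q)) -> q z <> z -> g z = z.
Proof.
move=> gq gcj qz; apply: contrapT => gz.
wlog zg : g gq gcj gz / z < g z => [hw|].
  have [/(hw g)||E] := ltgtP z (g z); [exact| |by rewrite -E in gz].
  move=> gzz; apply: (hw g^-1).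
  - exact/commute_sym/commuteV/commute_sym.
  - by move=> h; case: (gcj h) => H; [left|right]; exact/commute_sym/commuteV/commute_sym.
  - by move=> E; apply: gz; rewrite -{1}E autVK.
  - by rewrite -(aut_lt g) autVK.
wlog zq : q gq gcj qz / z < q z => [hw|].
  have [/(hw q)||E] := ltgtP z (q z); [exact| |by rewrite -E in qz].
  move=> qzz; apply: (hw q^-1).
  - exact/commuteV.
  - by move=> h; case: (gcj h) => H; [left|right]; rewrite cjV; exact/commuteV.
  - by move=> E; apply: qz; rewrite -{1}E autVK.
  - by rewrite -(aut_lt q) autVK.
have [y zy [yg yq]] : exists2 y, z < y & y <= g z /\ y <= q z.
  exists (Order.min (g z) (q z)); first by rewrite lt_min zg zq.
  by rewrite !ge_min !lexx orbT.
have [h0 [u hu [zu [uy hzy]]]] := local_nontrivial dhT zy.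
(* [h0] and its inverse move the same points, so either of the two commutations will do. *)
have [h hg [hu' {}hzy]] : exists2 h, commute g (cj h q) &
    h u <> u /\ forall w, h w <> w -> z < w /\ w < y.
  case: (gcj h0) => H; [exists h0 => //|exists h0^-1 => //].
  split=> [E|w hw]; first by apply: hu; rewrite -{1}E autVK.
  by apply: hzy => E; apply: hw; exact: aut_fixV.
have hV w : ~ (z < w /\ w < y) -> h w = w by move=> zwy; apply: contrapT => /hzy.
pose D := cj h q * q^-1.
have gD : commute g D by apply: commuteM => //; exact/commuteV.
have DE w : D w = h (q (h^-1 (q^-1 w))) by [].
have Du : D u <> u.
  rewrite DE (aut_fixV (hV _ _)) ?autVK // => -[zqu _].
  have : u < q z by exact: lt_le_trans yq.
  by rewrite -aut_ltV ltNge (ltW zqu).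
have Dz w : w <= z -> D w = w.
  move=> wz; rewrite DE (aut_fixV (hV _ _)) ?autVK ?hV //.
    by rewrite ltNge wz => -[].
  move=> [+ _]; rewrite ltNge aut_leV => /negP; apply; exact: le_trans (ltW zq).
apply: Du; rewrite -(autVK g u) -(commute_fun _ gD) Dz // aut_leV.
by apply: ltW; exact: lt_le_trans yg.
Qed.

Section HalfSupport.
Variables n p : oaut T.
Hypothesis np : half_line n p.

Definition side_supp : set T := fun y => exists2 g : oaut T, side n p g & g y <> y.

Let cjVK (h g : oaut T) : cj h^-1 (cj h g) = g.
Proof. by rewrite -{2}(invgK h) cjK. Qed.

Let cj_commute (h g q : oaut T) : commute g (cj h q) <-> commute (cj h^-1 g) q.
Proof.
have H (k a b : oaut T) : commute a b -> commute (cj k a) (cj k b).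
  move=> ab; rewrite /commute /cj !mulgA -!(mulgA _ k^-1 k) !mulVg !mulg1.
  by rewrite -(mulgA k) ab mulgA.
by split=> [/(H h^-1)|/(H h)]; rewrite ?cjVK ?cjK.
Qed.

(** For every [h], comparability of the conjugates of the group supplies one of the two commutations
    required by [commute_conj_fix]. *)
Lemma side_fix g k z : side n p g -> commute k n -> cj k p z <> z -> g z = z.
Proof.
move=> gA kn; apply: commute_conj_fix; first exact: gA.
move=> h; have [_ [_ /(_ h)[H|H]]] := np.
  by right; apply/cj_commute; rewrite invgK; exact: H.
by left; apply/cj_commute; apply: (H (cj h^-1 g)) => //; rewrite cjK.
Qed.

(** The group moves no point moved by the conjugates of [p] that define it, so everything supported
    on its support commutes with them and belongs to it. *)
Lemma side_suppP g : side n p g <-> forall z, ~ side_supp z -> g z = z.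
Proof.
split=> [gA z|gU k kn]; first by move=> nz; apply: contrapT => gz; apply: nz; exists g.
apply: commute_disjoint => z gz kz; apply: gz; apply: gU => -[f fA]; apply.
exact: side_fix kz.
Qed.

Lemma side_supp_stab h : side_stab n p h <-> act h side_supp = side_supp.
Proof.
split=> [st|hU g].
  apply/seteqP; split=> z [g gA gz].
    exists (cj h g); first by rewrite -st.
    by rewrite cjE => E; apply: gz; rewrite -{2}E autK.
  exists (cj h^-1 g); first by rewrite st cjK.
  by rewrite cjE invgK autVK => /aut_inj.
have Uh z : side_supp (h z) <-> side_supp z by rewrite -{1}hU act_aut.
rewrite !side_suppP; split=> gU z Uz.
  by rewrite cjE gU ?autVK // -Uh autVK.
by have := gU (h z); rewrite cjE autK Uh => /(_ Uz)/aut_inj.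
Qed.

Lemma side_supp_comparable h : act h side_supp `<=` side_supp \/ side_supp `<=` act h side_supp.
Proof.
have [_ [_ /(_ h)[H|H]]] := np; [left|right] => z [g gA gz].
  exists (cj h g); first exact: H.
  by rewrite cjE => E; apply: gz; rewrite -{2}E autK.
exists (cj h^-1 g); first by apply: (H (cj h^-1 g)); rewrite cjK.
by rewrite cjE invgK autVK => /aut_inj.
Qed.

(** An automorphism taking [x] to [y] and [y] to [z] would carry the support to a set incomparable
    with it. *)
Lemma side_supp_seg x y z : x < y -> y < z ->
  side_supp x -> side_supp z -> side_supp y.
Proof.
move=> xy yz Ux Uz; apply: contrapT => Uy; have [_ bt _] := dhT.
have [h [hx hy]] := bt _ _ _ _ xy yz.
have [H|H] := side_supp_comparable h.
  by apply: Uy; apply: H; rewrite -hx act_aut.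
by apply: Uy; have := H _ Uz; rewrite -hy act_aut.
Qed.

Lemma side_suppC_seg x y z : x < y -> y < z ->
  ~ side_supp x -> ~ side_supp z -> ~ side_supp y.
Proof.
move=> xy yz Ux Uz Uy; have [_ bt _] := dhT.
have [h [hx hy]] := bt _ _ _ _ yz xy.
have [H|H] := side_supp_comparable h.
  by apply: Ux; apply: H; rewrite -hx act_aut.
by apply: Uz; have := H _ Uy; rewrite -hy act_aut.
Qed.

Lemma side_supp_open x : side_supp x ->
  (exists2 y, side_supp y & x < y) /\ (exists2 y, side_supp y & y < x).
Proof.
move=> [g gA gx].
have gU : side_supp (g x) by exists g => // /aut_inj.
have gVx : g^-1 x <> x by move=> E; apply: gx; rewrite -{1}E autVK.
have gVU : side_supp (g^-1 x) by exists g => //; rewrite autVK => /esym.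
have [xg|gxx|/esym//] := ltgtP x (g x); split.
- by exists (g x).
- by exists (g^-1 x) => //; rewrite aut_ltV.
- by exists (g^-1 x) => //; rewrite -(aut_lt g) autVK.
- by exists (g x).
Qed.

(** The support and its complement are both convex, so the support is a lower or an upper set. A
    lower one is itself the cut; an upper one gives the cut through its complement. *)
Lemma half_line_cut : exists2 L, cut L & forall h, side_stab n p h <-> act h L = L.
Proof.
have [[g [/aut_neq1[a ga] gA]] [/aut_neq1[b pb] _]] := np.
have Ua : side_supp a by exists g.
have Ub : ~ side_supp b.
  move=> [f fA]; apply; apply: (side_fix (k := 1) fA); last by [].
  exact/commute_sym/commute1.
have [ab|ba|E] := ltgtP a b; last by rewrite E in Ua.
  exists side_supp; last exact: side_supp_stab.
  split; [|by exists a|by exists b|by move=> x /side_supp_open[]].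
  move=> x y Uy; rewrite le_eqVlt => /orP[/eqP->//|xy]; apply: contrapT => Ux.
  have [yb|b_y|E] := ltgtP y b; last by rewrite E in Uy.
    exact: (side_suppC_seg xy yb).
  by apply: Ub; exact: side_supp_seg b_y Ua Uy.
have up x y : side_supp x -> x < y -> side_supp y.
  move=> Ux xy; apply: contrapT => Uy.
  have [xb|bx|E] := ltgtP x b; last by rewrite E in Ux.
    by apply: Ub; exact: side_supp_seg xb ba Ux Ua.
  exact: (side_suppC_seg bx xy).
(* [F] drops a possible greatest element of the complement, which a cut must not have; [F'] recovers
   the support, so both sets have the same stabiliser. *)
pose F (U : set T) : set T := fun w => exists2 v, w < v & ~ U v.
pose F' (L : set T) : set T := fun w => exists2 v, v < w & ~ L v.
have FE h U : act h (F U) = F (act h U).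
  apply/seteqP; split=> w [v wv Uv].
    by exists (h v); rewrite ?act_aut // -aut_ltV.
  by exists (h^-1 v); rewrite // -(aut_lt h) !autVK.
have F'E h U : act h (F' U) = F' (act h U).
  apply/seteqP; split=> w [v wv Uv].
    by exists (h v); rewrite ?act_aut // -(aut_lt h^-1) autK.
  by exists (h^-1 v); rewrite // -(aut_lt h) !autVK.
have F'F : F' (F side_supp) = side_supp.
  apply/seteqP; split=> w.
    by move=> [v vw Fv]; apply: contrapT => Uw; apply: Fv; exists w.
  move=> /side_supp_open[_ [v Uv vw]]; exists v => // -[t vt]; apply.
  exact: up vt.
exists (F side_supp); last first.
  move=> h; rewrite side_supp_stab FE; split=> [->//|E].
  by rewrite -F'F F'E FE E.
split.
- by move=> x y [v yv Uv] xy; exists v => //; exact: le_lt_trans yv.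
- by have [x xb] := dh_lt dhT b; exists x, b.
- by exists a => -[v av]; apply; exact: up av.
- by move=> x [v xv Uv]; have [y xy yv] := dh_dense dhT xv; exists y => //; exists v.
Qed.

End HalfSupport.
End HalfLineCut.

(** * Integer powers and bicommutants *)

Section IntegerPowers.
Variable G : groupType.
Implicit Types f : G.

Definition zpow f (i : int) : G :=
  match i with Posz n => f ^+ n | Negz n => f ^- n.+1 end.

Lemma zpow_commute f i : commute f (zpow f i).
Proof. by case: i => n; [|apply: commuteV]; apply: commuteX. Qed.

Lemma zpowS f i : zpow f (i + 1)%R = f * zpow f i.
Proof.
case: i => [n|[|n]]; first by rewrite -[1%R]/(Posz 1) -PoszD addn1 /= expgS.
  by rewrite /= expg1 mulgV.
have -> : (Negz n.+1 + 1)%R = Negz n by rewrite !NegzE -(addn1 n.+1) PoszD GRing.opprD GRing.addrNK.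
by rewrite /zpow [f ^+ n.+2]expgSr invgM mulgA mulgV mul1g.
Qed.

Lemma zpowSr f i : zpow f (i + 1)%R = zpow f i * f.
Proof. by rewrite zpowS zpow_commute. Qed.

Lemma zpowV f i : zpow f^-1 i = zpow f (- i)%R.
Proof. by case: i => [[|n]|n] //=; rewrite expVgn ?invgK. Qed.

Lemma zpow_quot f m n : exists i, f ^- m * f ^+ n = zpow f i.
Proof.
have [mn|nm] := leqP m n.
  by exists (n - m)%N; rewrite /= -{1}(subnKC mn) expgnDr mulKg.
exists (- (m - n)%N%:Z)%R; rewrite -zpowV /= expVgn -{1}(subnKC (ltnW nm)) expgnDr invgM.
by rewrite -mulgA mulVg mulg1.
Qed.

Definition bicommutes f s := forall c, commute c f -> commute c s.

Lemma bicommutesV f s : bicommutes f s -> bicommutes f s^-1.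
Proof. by move=> fs c /fs/commuteV. Qed.

Lemma bicommutesM f s t : bicommutes f s -> bicommutes f t -> bicommutes f (s * t).
Proof. by move=> fs ft c cf; apply: commuteM; [exact: fs|exact: ft]. Qed.

Lemma bicommutes_zpow f i : bicommutes f (zpow f i).
Proof. by case: i => n c cf; [|apply: commuteV]; apply: commuteX. Qed.

End IntegerPowers.

(** * The orbit of a cut under a bicommutant *)

Section BicommutantOrbits.
Context {d : Order.disp_t} {T : orderType d}.
Implicit Types (c f g h k s : oaut T) (x y z t u v : T) (L M : set T).
Hypothesis dhT : doubly_homogeneous (T := T).

(** The part of [f] off [L] commutes with [f], hence with [s]; being the identity on [L], it is the
    identity on [s L] too. So [f] is trivial on the part of [s L] outside [L], and a bump there
    commutes with [f] but not with [s]. *)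
Lemma bicommutes_fix_sub f s L : cut L -> bicommutes f s -> act f L = L -> act s L `<=` L.
Proof.
move=> cL fs fL; apply: contrapT => nsL; have [Ll _ _ _] := cL.
have [x [y [Mx My Lx Ly xy]]] := cut_gap cL (act_cut s cL) nsL.
have fL' z : L (f z) <-> L z by rewrite -{1}fL act_aut.
have [|z|c [cN cL']] := @restrict _ _ (~` L) f.
- by move=> r t u Lr _ rt _ Lt; apply: Lr; exact: Ll rt.
- by rewrite /setC /= fL'.
have {}cL' z : L z -> c z = z by move=> Lz; apply: cL'; exact.
have cf : commute c f.
  apply: oaut_eq => z; change (c (f z) = f (c z)).
  have [Lz|Lz] := pselect (L z); first by rewrite !cL' // fL'.
  by rewrite !cN // /setC /= fL'.
have sf z : act s L z -> ~ L z -> f z = z.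
  move=> sz Lz; rewrite -cN // -(autVK s z) (commute_fun _ (fs _ cf)) cL' //.
have [h [u hu [xu [uy hxy]]]] := local_nontrivial dhT xy.
have gap w : x < w -> w < y -> act s L w /\ ~ L w.
  move=> xw wy; split; last by move=> Lw; apply: Lx; apply: Ll Lw _; exact: ltW.
  by have [sl _ _ _] := act_cut s cL; apply: sl My _; exact: ltW.
have hf : commute h f.
  by apply: commute_disjoint => w /hxy[xw wy]; apply; have [/sf] := gap w xw wy; apply.
have [su Lu] := gap u xu uy.
apply: hu; rewrite -{1}(autVK s u) (commute_fun _ (fs _ hf)).
rewrite [h _](_ : _ = s^-1 u) ?autVK //; apply: contrapT => /hxy[xs sy].
by case: (gap _ xs sy).
Qed.

Lemma bicommutes_fix f s L : cut L -> bicommutes f s -> act f L = L -> act s L = L.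
Proof.
move=> cL fs fL; apply/seteqP; split; first exact: bicommutes_fix_sub fL.
by apply/(act_subE s^-1); rewrite actK; apply: bicommutes_fix_sub fL => //; exact: bicommutesV.
Qed.

Lemma act_zpow_mono f i j L : L `<=` act f L -> (i <= j)%R ->
  act (zpow f i) L `<=` act (zpow f j) L.
Proof.
move=> Lf ij; have -> : j = (i + `|j - i|%N%:Z)%R.
  by rewrite gez0_abs ?Num.Theory.subr_ge0 // [RHS]GRing.addrC GRing.subrK.
elim: `|j - i|%N => [|m IH]; first by rewrite GRing.addr0.
rewrite -addn1 PoszD GRing.addrA zpowSr actM; apply: subset_trans IH _.
exact: act_sub.
Qed.

(* [h] moves a point [u] just above [L]; its conjugates by the powers of [f] glue
   to an element commuting with [f], hence with [s], that fixes [s u]. *)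
Lemma bicommutes_step f s L : cut L -> bicommutes f s -> L `<=` act f L ->
  L `<=` act s L -> ~ act f L `<=` act s L -> act s L = L.
Proof.
move=> cL fs Lf Ls nfs.
have [Ll _ _ _] := cL.
have [fl _ _ _] := act_cut f cL; have [sl _ _ _] := act_cut s cL.
have sf : act s L `<=` act f L by case: (lower_total fl sl).
suff sL : act s L `<=` L by apply/seteqP.
apply: contrapT => nsL.
pose N := act (s^-1 * f) L.
have cN : cut N by exact: act_cut.
have nN : ~ N `<=` L.
  move=> NL; apply: nfs; apply/(act_subE s^-1).
  by rewrite actK -actM.
(* [K] is the smaller of [s L] and [N]: it lies in [s L], and [s] maps it into [f L]. *)
have [K [cK nK Ks KN]] : exists K, [/\ cut K, ~ K `<=` L, K `<=` act s L & K `<=` N].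
  have [Nl _ _ _] := cN; have [H|H] := lower_total sl Nl.
    by exists (act s L); split=> //; exact: act_cut.
  by exists N; split.
have [x [y [Kx Ky Lx Ly xy]]] := cut_gap cL cK nK.
have gap w : x < w -> w < y -> K w /\ ~ L w.
  move=> xw wy; split; last by move=> Lw; apply: Lx; apply: Ll Lw _; exact: ltW.
  by case: cK => Kl _ _ _; apply: Kl Ky _; exact: ltW.
have [h [u hu [xu [uy hxy]]]] := local_nontrivial dhT xy.
(* The images of the interval between [x] and [y] under the powers of [f]; they are disjoint because
   that interval lies in [f L] and outside [L]. *)
pose V i : set T := fun w => x < (zpow f i)^-1 w /\ (zpow f i)^-1 w < y.
have VL i w : V i w -> act (zpow f (i + 1)%R) L w /\ ~ act (zpow f i) L w.
  move=> [xw wy]; have [Kw Lw] := gap _ xw wy; split=> //.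
  by rewrite zpowSr actM; apply: sf; exact: Ks.
have VS i w : V (i + 1)%R (f w) <-> V i w.
  have E : (zpow f (i + 1)%R)^-1 (f w) = (zpow f i)^-1 w.
    by rewrite zpowS invgM; change ((zpow f i)^-1 (f^-1 (f w)) = (zpow f i)^-1 w); rewrite autK.
  by rewrite /V E.
have mono i j := @act_zpow_mono f i j L Lf.
have disj i j w : V i w -> V j w -> (i < j)%R -> False.
  move=> /VL[iw _] /VL[_ jw] ij; apply: jw; apply: mono iw.
  by rewrite lezD1.
have hfix w : ~ (x < w /\ w < y) -> h w = w by move=> nw; apply: contrapT => /hxy.
have hx : h x = x by apply: hfix; rewrite ltxx => -[].
have hy : h y = y by apply: hfix; rewrite ltxx => -[].
have [| |i w|c [cV cN']] := @glue _ _ _ V (fun i => cj (zpow f i) h).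
- move=> i r t v [xr _] [_ vy] rt tv; split.
    by apply: lt_le_trans xr _; rewrite aut_le.
  by apply: le_lt_trans vy; rewrite aut_le.
- move=> i j w Vi Vj; have [ij|ji|//] := ltgtP i j; first by case: (disj i j w).
  by case: (disj j i w).
- by rewrite /V cjE autK -{1}hx -{1}hy !aut_lt.
have cf : commute c f.
  apply: oaut_eq => w; change (c (f w) = f (c w)).
  have [[i Vi]|/forallNP nV] := pselect (exists i, V i w).
    rewrite (cV _ _ Vi) (cV (i + 1)%R) ?VS // zpowS !cjE invgM.
    by change (f (zpow f i (h ((zpow f i)^-1 (f^-1 (f w))))) =
               f (zpow f i (h ((zpow f i)^-1 w)))); rewrite autK.
  rewrite !cN' // => i Vi; apply: (nV (i - 1)%R).
  by apply/VS; rewrite GRing.subrK.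
have cu : c u = h u by rewrite (cV 0%R).
have csu : c (s u) <> s u by rewrite (commute_fun _ (fs _ cf)) cu => /aut_inj.
have [i Vi] : exists i, V i (s u).
  by apply: contrapT => /forallNP nV; apply: csu; exact: cN'.
have [Ku Lu] := gap u xu uy; have [Vi1 Vi2] := VL _ _ Vi.
have nsu : ~ act s L (s u) by rewrite act_aut.
have fsu : act f L (s u).
  by have := KN _ Ku; rewrite /N actM /act invgK.
(* [s u] lies in [f L] and outside [L], where only the interval of index [0] is found; but that
   interval is inside [s L], which omits [s u]. *)
have i0 : i = 0%R.
  apply: le_anti; apply/andP; split; rewrite leNgt; apply/negP => i0.
    by apply: Vi2; apply: (mono 1%R i) fsu; rewrite -lezD1 in i0.
  by apply: nsu; apply: Ls; apply: (mono (i + 1)%R 0%R) Vi1; rewrite lezD1.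
rewrite i0 in Vi; have [sx sy] := Vi.
by apply: nsu; apply: Ks; have [] := gap _ sx sy.
Qed.

(** Otherwise the union of the [f ^ n L] is a cut fixed by [f], hence by [s]. It then equals [s L],
    and so [L], which [f] does not fix. *)
Lemma not_bicommutes_unbounded f s L : cut L -> bicommutes f s -> L `<=` act f L ->
  act f L <> L -> exists n, ~ act (f ^+ n) L `<=` act s L.
Proof.
move=> cL fs Lf nf; apply: contrapT => /forallNP H.
have {}H n : act (f ^+ n) L `<=` act s L by apply: contrapT; exact: H.
have [Ll [a La] _ Lm] := cL; have [_ _ [b sb] _] := act_cut s cL.
pose E : set T := fun x => exists n, act (f ^+ n) L x.
have cE : cut E.
  split.
  - by move=> x y [n Ln] xy; exists n; have [l _ _ _] := act_cut (f ^+ n) cL; apply: l Ln xy.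
  - by exists a, 0%N.
  - by exists b => -[n /H].
  - move=> x [n Lx]; have [_ _ _ /(_ _ Lx)[y Ly xy]] := act_cut (f ^+ n) cL.
    by exists y => //; exists n.
have fE : act f E = E.
  apply/seteqP; split=> x [n Lx].
    by exists n.+1; rewrite expgS.
  by exists n; have : act (f ^+ n * f) L x; [rewrite actM; exact: act_sub Lx|rewrite -expgSr expgS].
have sE := bicommutes_fix cE fs fE.
have EsL : E = act s L.
  apply/seteqP; split=> [x [n /H]//|]; rewrite -sE; apply: act_sub => x Lx.
  by exists 0%N.
apply: nf; have <- : E = L by apply: (can_inj (actK s)); rewrite sE.
exact: fE.
Qed.

(** Up to inversion, [f] moves the cut upwards. A power of [g] brings [s L] above [L]; dividing off
    the largest power of [g] that fits leaves an element to which [bicommutes_step] applies, and it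
    fixes [L]. *)
Lemma bicommutes_orbit f s L : cut L -> bicommutes f s ->
  exists i, act s L = act (zpow f i) L.
Proof.
move=> cL fs.
suff main g : bicommutes g s -> L `<=` act g L -> act g L <> L ->
    exists i, act s L = act (zpow g i) L.
  have [E|nE] := pselect (act f L = L); first by exists 0%R; rewrite (bicommutes_fix cL fs E).
  have [Ll _ _ _] := cL; have [fl _ _ _] := act_cut f cL.
  have [Lf|fL] := lower_total Ll fl; first exact: main.
  have fV : bicommutes f^-1 s by move=> c /commuteV; rewrite invgK; exact: fs.
  have [||i ->] := main _ fV.
  - by apply/(act_subE f); rewrite actVK.
  - by move=> E; apply: nE; rewrite -{1}E actVK.
  by exists (- i)%R; rewrite zpowV.
move=> gs Lg ng.
have sg : commute g s by exact: gs.
have [m nm] := not_bicommutes_unbounded cL (bicommutesV gs) Lg ng.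
pose r := g ^+ m * s.
have gr : bicommutes g r.
  by apply: bicommutesM gs => c cg; exact: commuteX.
have Lr : L `<=` act r L.
  rewrite /r; have -> : g ^+ m * s = s * g ^+ m by exact/commute_sym/commuteX/commute_sym.
  apply/(act_subE s^-1); rewrite actM actK.
  by have [l1 _ _ _] := act_cut (g ^+ m) cL; have [l2 _ _ _] := act_cut s^-1 cL;
     case: (lower_total l1 l2).
have [n Ln nn] : exists2 n, act (g ^+ n) L `<=` act r L & ~ act (g ^+ n.+1) L `<=` act r L.
  have [n nn] := not_bicommutes_unbounded cL gr Lg ng.
  apply: contrapT => H; apply: nn; elim: n => [//|n IH]; apply: contrapT => nn.
  by apply: H; exists n.
have rL : act ((g ^+ n)^-1 * r) L = L.
  apply: (bicommutes_step cL _ Lg).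
  - by apply: bicommutesM gr; apply: bicommutesV => c cg; exact: commuteX.
  - by apply/(act_subE (g ^+ n)); rewrite actM actVK.
  - by move=> /(act_sub (f := g ^+ n)); rewrite actM actVK -actM -expgSr.
have [i gi] := zpow_quot g m n; exists i.
by rewrite -gi actM -{2}rL actM actVK /r actM actK.
Qed.

End BicommutantOrbits.

(** * Cantor's back-and-forth theorem *)

Section Cantor.

(** Stated for a bare relation on a subset, so as to cover one side of a cut, sets of cuts under
    strict inclusion, lexicographic pairs and the dyadic numbers. *)
Definition countable_dlo (T : Type) (lt : T -> T -> Prop) (X : set T) :=
  [/\ (forall x, ~ lt x x) /\ (forall y x z, lt x y -> lt y z -> lt x z),
      forall x y, X x -> X y -> x = y \/ (lt x y \/ lt y x),
      forall x y, X x -> X y -> lt x y -> exists2 z, X z & lt x z /\ lt z y,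
      forall x, X x -> (exists2 y, X y & lt y x) /\ (exists2 y, X y & lt x y) &
      exists2 x, X x & exists u : nat -> T, forall x, X x -> exists n, u n = x].

Lemma dlo_flip (T : Type) (lt : T -> T -> Prop) (X : set T) :
  countable_dlo lt X -> countable_dlo (fun x y => lt y x) X.
Proof.
move=> [[ir tr] tot den ends cnt]; split=> //.
- by split=> // y x z xy yz; exact: tr yz xy.
- by move=> x y Xx Xy; have [|[|]] := tot x y Xx Xy; [left|right; right|right; left].
- by move=> x y Xx Xy /(den _ _ Xy Xx)[z Xz [yz zx]]; exists z.
- by move=> x /ends[].
Qed.

Lemma dlo_max (T : eqType) (lt : T -> T -> Prop) (X : set T) (a : T) (s : seq T) :
  countable_dlo lt X -> (forall x, x \in a :: s -> X x) ->
  exists2 m, m \in a :: s & forall x, x \in a :: s -> x = m \/ lt x m.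
Proof.
move=> [[ir tr] tot _ _ _]; elim: s a => [|b s IH] a sX.
  by exists a; rewrite ?mem_head // => x; rewrite inE => /eqP; left.
have [|m ms mmax] := IH b; first by move=> x xs; apply: sX; rewrite inE xs orbT.
have Xm : X m by apply: sX; rewrite inE ms orbT.
have [am|[am|ma]] := tot a m (sX _ (mem_head _ _)) Xm.
- exists m; first by rewrite -am mem_head.
  by move=> x; rewrite inE => /orP[/eqP->|/mmax//]; left.
- exists m; first by rewrite inE ms orbT.
  by move=> x; rewrite inE => /orP[/eqP->|/mmax//]; right.
- exists a; first exact: mem_head.
  move=> x; rewrite inE => /orP[/eqP->|/mmax[->|xm]]; [by left|by right|right].
  exact: tr xm ma.
Qed.

Lemma dlo_between (T : eqType) (lt : T -> T -> Prop) (X : set T) (r s : seq T) :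
  countable_dlo lt X -> (forall x, x \in r -> X x) -> (forall x, x \in s -> X x) ->
  (forall x y, x \in r -> y \in s -> lt x y) ->
  exists2 z, X z & (forall x, x \in r -> lt x z) /\ (forall y, y \in s -> lt z y).
Proof.
move=> dX; have [[ir tr] tot den ends [a Xa _]] := dX.
(* The four cases rest in turn on non-emptiness, the lack of a first element, the lack of a last
   one, and density. *)
case: r => [|b r] rX; case: s => [|c s] sX rs.
- by exists a.
- have [m ms mmin] := dlo_max (dlo_flip dX) sX.
  have [[z Xz zm] _] := ends _ (sX _ ms); exists z => //; split=> // y /mmin[->//|].
  exact: tr zm.
- have [m mr mmax] := dlo_max dX rX.
  have [_ [z Xz mz]] := ends _ (rX _ mr); exists z => //; split=> // y /mmax[->//|ym].
  exact: tr ym mz.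
- have [m ms mmin] := dlo_max (dlo_flip dX) sX; have [k kr kmax] := dlo_max dX rX.
  have [z Xz [kz zm]] := den _ _ (rX _ kr) (sX _ ms) (rs _ _ kr ms).
  exists z => //; split=> [y /kmax[->//|yk]|y /mmin[->//|]]; first exact: tr yk kz.
  exact: tr zm.
Qed.

Definition partial_iso (T1 T2 : eqType) (lt1 : T1 -> T1 -> Prop) (lt2 : T2 -> T2 -> Prop)
    (X : set T1) (Y : set T2) (s : seq (T1 * T2)) :=
  (forall p, p \in s -> X p.1 /\ Y p.2) /\
  (forall p q, p \in s -> q \in s -> lt1 p.1 q.1 <-> lt2 p.2 q.2).

Lemma partial_iso_swap T1 T2 lt1 lt2 X Y s :
  @partial_iso T1 T2 lt1 lt2 X Y s ->
  @partial_iso T2 T1 lt2 lt1 Y X [seq (p.2, p.1) | p <- s].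
Proof.
move=> [sXY slt]; split=> [p /mapP[q qs ->]|p q /mapP[p' ps ->] /mapP[q' qs ->]] /=.
  by have [] := sXY q qs.
by rewrite slt.
Qed.

Lemma partial_iso_extend T1 T2 lt1 lt2 X Y s x :
  countable_dlo lt1 X -> countable_dlo lt2 Y -> @partial_iso T1 T2 lt1 lt2 X Y s ->
  X x -> exists y, @partial_iso T1 T2 lt1 lt2 X Y ((x, y) :: s).
Proof.
move=> dX dY [sXY slt] Xx.
have [[p ps px]|nx] := pselect (exists2 p, p \in s & p.1 = x).
  exists p.2; have -> : (x, p.2) = p by case: p px {ps} => a b /= ->.
  by split=> [q|q r]; rewrite !inE => /orP[/eqP->|qs]; try move=> /orP[/eqP->|rs]; auto.
have [[ir1 tr1] tot1 _ _ _] := dX; have [[ir2 tr2] tot2 _ _ _] := dY.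
have [||y' z|y Yy [yr ys]] := @dlo_between _ lt2 Y
  [seq p.2 | p <- s & `[<lt1 p.1 x>]] [seq p.2 | p <- s & `[<lt1 x p.1>]] dY.
- by move=> y /mapP[p]; rewrite mem_filter => /andP[_ /sXY[_ Yp]] ->.
- by move=> y /mapP[p]; rewrite mem_filter => /andP[_ /sXY[_ Yp]] ->.
- move=> /mapP[p]; rewrite mem_filter => /andP[/asboolP px ps] ->.
  move=> /mapP[q]; rewrite mem_filter => /andP[/asboolP xq qs] ->.
  by rewrite -slt //; exact: tr1 px xq.
have lo p : p \in s -> lt1 p.1 x -> lt2 p.2 y.
  move=> ps px; apply: yr; apply/mapP; exists p => //; rewrite mem_filter ps andbT.
  exact/asboolP.
have hi p : p \in s -> lt1 x p.1 -> lt2 y p.2.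
  move=> ps px; apply: ys; apply/mapP; exists p => //; rewrite mem_filter ps andbT.
  exact/asboolP.
have cases p : p \in s -> (lt1 p.1 x /\ lt2 p.2 y) \/ (lt1 x p.1 /\ lt2 y p.2).
  move=> ps; have [Xp Yp] := sXY p ps.
  have [px|[px|xp]] := tot1 p.1 x Xp Xx; first by case: nx; exists p.
    by left; split=> //; exact: lo.
  by right; split=> //; exact: hi.
exists y; split=> [p|p q]; rewrite !inE; first by move=> /orP[/eqP->|/sXY].
move=> /orP[/eqP->|ps] /orP[/eqP->|qs] /=; last exact: slt.
- by split=> [/ir1|/ir2].
- have [[qx qy]|[? ?]] := cases q qs; last by split.
  by split=> H; [case: (ir1 x); exact: tr1 H qx|case: (ir2 y); exact: tr2 H qy].
- have [[? ?]|[xp yp]] := cases p ps; first by split.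
  by split=> H; [case: (ir1 x); exact: tr1 xp H|case: (ir2 y); exact: tr2 yp H].
Qed.

(** Stage [n] puts the [n]-th terms of both enumerations into a growing finite partial isomorphism;
    terms outside [X] or [Y] are skipped. *)
Theorem cantor_iso (T1 T2 : eqType) lt1 lt2 (X : set T1) (Y : set T2) :
  countable_dlo lt1 X -> countable_dlo lt2 Y ->
  exists (F : T1 -> T2) (G : T2 -> T1),
    [/\ forall x, X x -> Y (F x) /\ G (F x) = x,
        forall y, Y y -> X (G y) /\ F (G y) = y &
        forall x x', X x -> X x' -> lt1 x x' -> lt2 (F x) (F x')].
Proof.
move=> dX dY; pose P := @partial_iso T1 T2 lt1 lt2 X Y.
have [[ir1 tr1] tot1 _ _ [a Xa [u uX]]] := dX.
have [[ir2 tr2] tot2 _ _ [b Yb [v vY]]] := dY.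
have step (q : nat * {s | P s}) : exists s' : {s | P s},
    [/\ {subset sval q.2 <= sval s'}, X (u q.1) -> exists y, (u q.1, y) \in sval s' &
        Y (v q.1) -> exists x, (x, v q.1) \in sval s'].
  case: q => n [s Ps] /=.
  have [s1 Ps1 [ss1 us1]] : exists2 s1, P s1 &
      {subset s <= s1} /\ (X (u n) -> exists y, (u n, y) \in s1).
    have [Xu|nX] := pselect (X (u n)); last by exists s => //; split.
    have [y Py] := partial_iso_extend dX dY Ps Xu; exists ((u n, y) :: s) => //.
    by split=> [p ps|_]; [rewrite inE ps orbT|exists y; rewrite mem_head].
  have [Yv|nY] := pselect (Y (v n)); last by exists (exist _ s1 Ps1); split.
  have [x /partial_iso_swap Px] := partial_iso_extend dY dX (partial_iso_swap Ps1) Yv.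
  have sub : {subset s1 <= [seq (p.2, p.1) | p <- (v n, x) :: [seq (p.2, p.1) | p <- s1]]}.
    move=> [c e] ps; rewrite /= inE -map_comp; apply/orP; right.
    by apply/mapP; exists (c, e).
  exists (exist _ _ Px); split=> /=.
  - by move=> p /ss1/sub.
  - by move=> /us1[y yP]; exists y; exact: sub yP.
  - by move=> _; exists x; rewrite mem_head.
have [f fP] := choice step.
have P0 : P [::] by split.
pose S := fix S n : {s | P s} := if n is m.+1 then f (m, S m) else exist _ [::] P0.
pose R x y := exists n, (x, y) \in sval (S n).
have Smono m n : (m <= n)%N -> {subset sval (S m) <= sval (S n)}.
  move=> /subnKC <-; elim: (n - m)%N => [|k IH]; first by rewrite addn0.
  by move=> p /IH; rewrite addnS /=; case: (fP ((m + k)%N, S (m + k)%N)) => + _ _; apply.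
have RXY x y : R x y -> X x /\ Y y.
  by move=> [n]; case: (S n) => s [sXY _] /= /sXY.
have Rlt x y x' y' : R x y -> R x' y' -> lt1 x x' <-> lt2 y y'.
  move=> [m xm] [n xn]; have := Smono _ _ (leq_maxl m n) _ xm.
  have := Smono _ _ (leq_maxr m n) _ xn.
  by case: (S (maxn m n)) => s [_ slt] /= p q; exact: (slt (x, y) (x', y')).
have RX x : X x -> exists y, R x y.
  move=> Xx; have [n un] := uX x Xx; have [_ + _] := fP (n, S n).
  by rewrite /= un => /(_ Xx)[y xy]; exists y, n.+1.
have RY y : Y y -> exists x, R x y.
  move=> Yy; have [n vn] := vY y Yy; have [_ _ +] := fP (n, S n).
  by rewrite /= vn => /(_ Yy)[x xy]; exists x, n.+1.
have Rfun x y y' : R x y -> R x y' -> y = y'.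
  move=> xy xy'; have [_ Yy] := RXY _ _ xy; have [_ Yy'] := RXY _ _ xy'.
  by have [//|[/(Rlt _ _ _ _ xy xy')/ir1|/(Rlt _ _ _ _ xy' xy)/ir1]] := tot2 y y' Yy Yy'.
have Rinj x x' y : R x y -> R x' y -> x = x'.
  move=> xy xy'; have [Xx _] := RXY _ _ xy; have [Xx' _] := RXY _ _ xy'.
  by have [//|[/(Rlt _ _ _ _ xy xy')/ir2|/(Rlt _ _ _ _ xy' xy)/ir2]] := tot1 x x' Xx Xx'.
have [F FR] : {F : T1 -> T2 | forall x, X x -> R x (F x)}.
  apply/cid; suff /choice[F ?] : forall x, exists y, X x -> R x y by exists F.
  by move=> x; have [/RX[y]|nX] := pselect (X x); [exists y|exists b].
have [G GR] : {G : T2 -> T1 | forall y, Y y -> R (G y) y}.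
  apply/cid; suff /choice[G ?] : forall y, exists x, Y y -> R x y by exists G.
  by move=> y; have [/RY[x]|nY] := pselect (Y y); [exists x|exists a].
exists F, G; split=> [x Xx|y Yy|x x' Xx Xx'].
- have xF := FR x Xx; have [_ YF] := RXY _ _ xF; split=> //.
  exact: Rinj (GR _ YF) xF.
- have Gy := GR y Yy; have [XG _] := RXY _ _ Gy; split=> //.
  exact: Rfun (FR _ XG) Gy.
- by rewrite (Rlt _ _ _ _ (FR x Xx) (FR x' Xx')).
Qed.

End Cantor.

(** * Orbits of pairs and cuts of countable cofinality *)

Section CutGenerators.
Context {d : Order.disp_t} {T : orderType d}.
Implicit Types (c f g h k n p s : oaut T) (x y z t u v : T) (L M : set T).
Hypothesis dhT : doubly_homogeneous (T := T).

(** Conjugacy of the stabilisers of two cuts; by [stab_cut_inj] it amounts to the cuts lying in one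
    orbit. *)
Definition same_orbit (G : groupType) (n p n1 p1 : G) :=
  exists h : G, forall y : G, side_stab n p y <-> side_stab n1 p1 (cj h y).

Definition boundary n p L := cut L /\ forall h, side_stab n p h <-> act h L = L.

Lemma boundary_same_orbit n p n1 p1 L M : boundary n p L -> boundary n1 p1 M ->
  same_orbit n p n1 p1 <-> exists h, act h L = M.
Proof.
move=> [cL sL] [cM sM].
have E h (y : oaut T) : act (cj h y) M = M <-> act y (act h^-1 M) = act h^-1 M.
  rewrite /cj !actM; split=> [H|->]; last by rewrite actVK.
  by rewrite -[in RHS]H actK.
split=> [[h st]|[h hL]]; exists h; last first.
  by move=> y; rewrite sL sM E -hL actK.
suff -> : L = act h^-1 M by rewrite actVK.
apply: (stab_cut_inj dhT cL); first exact: act_cut.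
by move=> y; rewrite -sL st sM E.
Qed.

Lemma cofinal_increasing L (a : nat -> T) : cut L -> (forall i, L (a i)) ->
  exists e : nat -> T, [/\ forall i, L (e i), forall i, e i < e i.+1 & forall i, a i <= e i.+1].
Proof.
move=> [Ll _ _ Lm] La.
have step (q : nat * {x | L x}) : exists y : {x | L x}, sval q.2 < sval y /\ a q.1 <= sval y.
  case: q => i [x Lx] /=; have Lmax : L (Order.max x (a i)) by case: leP.
  have [y Ly] := Lm _ Lmax; rewrite gt_max => /andP[xy ay].
  by exists (exist _ y Ly); rewrite /= ltW ?ay.
have [f fP] := choice step.
pose e := fix e (i : nat) : {x | L x} := if i is j.+1 then f (j, e j)
  else exist _ (a 0%N) (La 0%N).
exists (fun i => sval (e i)); split=> i; first exact: (svalP (e i)).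
  by case: (fP (i, e i)).
by case: (fP (i, e i)).
Qed.

(** [n] is pasted from bumps between consecutive terms of a cofinal sequence of [L], which makes its
    support cofinal in [L]; [p] is a single bump off [L]. *)
Lemma cut_generators L (a : nat -> T) : cut L -> (forall i, L (a i)) ->
  (forall x, L x -> exists i, x <= a i) -> exists n p, half_line n p /\ boundary n p L.
Proof.
move=> cL La aL; have [e [Le eS ae]] := cofinal_increasing cL La.
have [Ll _ [b Lb] _] := cL.
have emono i j : (i <= j)%N -> e i <= e j.
  by move=> /subnKC <-; elim: (j - i)%N => [|m IH]; rewrite ?addn0 // addnS (le_trans IH) // ltW.
have loc i : exists h : oaut T, (exists2 u, h u <> u & e i < u) /\
    forall z, h z <> z -> e i < z /\ z < e i.+1.
  have [h [u hu [eu [_ hz]]]] := local_nontrivial dhT (eS i).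
  by exists h; split=> //; exists u.
have [h hP] := choice loc.
pose V i : set T := fun z => e i < z /\ z < e i.+1.
have disj i j z : V i z -> V j z -> (i < j)%N -> False.
  move=> [_ zi] [jz _] /emono ij; have := lt_trans (lt_le_trans zi ij) jz.
  by rewrite ltxx.
have [| |i z|n [nV nN]] := @glue _ _ _ V h.
- by move=> i x y z [ix _] [_ zi] xy yz; split; [exact: lt_le_trans xy|exact: le_lt_trans zi].
- move=> i j z Vi Vj; have [ij|ji|//] := ltngtP i j; first by case: (disj i j z).
  by case: (disj j i z).
- have [_ hi] := hP i.
  have he : h i (e i) = e i by apply: contrapT => /hi[]; rewrite ltxx.
  have he' : h i (e i.+1) = e i.+1 by apply: contrapT => /hi[_]; rewrite ltxx.
  by rewrite /V -{1}he -{1}he' !aut_lt.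
have [b' bb'] := dh_gt dhT b; have [p [w pw [_ [_ pb]]]] := local_nontrivial dhT bb'.
have nL z : n z <> z -> L z.
  move=> nz; apply: contrapT => Lz; apply: nz; apply: nN => i [_ zi].
  by apply: Lz; apply: Ll (Le i.+1) (ltW zi).
have Ln x : L x -> exists2 y, x <= y & n y <> y.
  move=> /aL[i xa]; have [[u hu eu] hi] := hP i.+1; exists u.
    by apply: le_trans xa (le_trans (ae i) (ltW eu)).
  by rewrite (nV i.+1) //; exact: hi.
have p1 : p <> 1 by move=> p1; rewrite p1 in pw.
have pL z : p z <> z -> ~ L z.
  by move=> /pb[bz _] Lz; apply: Lb; apply: Ll Lz (ltW bz).
exists n, p; split; first exact: (cut_half_line dhT cL nL Ln p1 pL).
split=> // k; exact: (cut_side_stab dhT cL nL Ln p1 pL).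
Qed.

End CutGenerators.

Lemma order_dlo d (T : orderType d) (L : set T) :
  (forall x y, L x -> L y -> x < y -> exists2 z, L z & x < z /\ z < y) ->
  (forall x, L x -> (exists2 y, L y & y < x) /\ (exists2 y, L y & x < y)) ->
  (exists x, L x) -> (exists u : nat -> T, forall x, L x -> exists n, u n = x) ->
  countable_dlo (fun x y => x < y) L.
Proof.
move=> den ends [x Lx] cnt; split=> //; last by exists x.
- by split=> [y|y z t]; [rewrite ltxx|exact: lt_trans].
- by move=> y z _ _; case: (ltgtP y z); [right; left|right; right|left].
Qed.

Lemma dh_dlo d (T : orderType d) : doubly_homogeneous (T := T) ->
  (exists u : nat -> T, forall x, exists n, u n = x) ->
  countable_dlo (fun x y : T => x < y) setT.
Proof.
move=> dhT [u uT]; apply: order_dlo.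
- by move=> x y _ _ /(dh_dense dhT)[z xz zy]; exists z.
- by move=> x _; have [y yx] := dh_lt dhT x; have [z xz] := dh_gt dhT x; split; [exists y|exists z].
- by case: dhT => _ _ [x _]; exists x.
- by exists u => x _.
Qed.

Lemma rat_dlo : countable_dlo (fun x y : rat => x < y) setT.
Proof.
apply: order_dlo => [x y _ _ xy|x _||].
- by exists ((x + y) / 2)%R => //; have [] := Num.Theory.midf_lt xy.
- split; [exists (x - 1)%R|exists (x + 1)%R] => //.
    by rewrite Num.Theory.ltrBlDr Num.Theory.ltrDl.
  by rewrite Num.Theory.ltrDl.
- by exists 0%R.
- by exists (fun n => odflt 0%R (unpickle n)) => x _; exists (pickle x); rewrite pickleK.
Qed.

Lemma countable_iso d1 d2 (T1 : orderType d1) (T2 : orderType d2) :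
  countable_dlo (fun x y : T1 => x < y) setT -> countable_dlo (fun x y : T2 => x < y) setT ->
  order_isomorphic T1 T2.
Proof.
move=> d1T d2T; have [F [G [FK GK Flt]]] := cantor_iso d1T d2T.
exists F; first by exists G => x; [case: (FK x)|case: (GK x)].
by apply: ltW_homo => x y; exact: Flt.
Qed.

(** * Recognising the irrationals *)

Section IrrationalChain.
Variable R : realType.
Context {d : Order.disp_t} {T : orderType d}.
Implicit Types (x y z : T) (L M : set T) (r : R) (q : rat).
Hypothesis dhT : doubly_homogeneous (T := T).

Definition proper_sub L M := L `<=` M /\ ~ M `<=` L.

Variable D : set (set T).
Hypothesis D_cut : forall L, D L -> cut L.
Hypothesis D_nonprincipal : forall L x, D L -> L <> [set y | y < x].
Hypothesis D_dense : forall x y, x < y -> exists2 L, D L & L x /\ ~ L y.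
Hypothesis D_complete : forall L, cut L -> ~ D L -> exists x, L = [set y | y < x].
Hypothesis D_countable : exists u : nat -> set T, forall L, D L -> exists n, u n = L.

Lemma D_dlo : countable_dlo proper_sub D.
Proof.
have sep L M x : D L -> D M -> L x -> ~ M x -> proper_sub M L.
  move=> /D_cut[Ll _ _ _] /D_cut[Ml _ _ _] Lx Mx; split; last by move=> /(_ x Lx).
  by case: (lower_total Ll Ml) => // /(_ x Lx).
split=> //.
- split=> [L [LL]|M L N [LM nML] [MN nNM]]; first exact.
  by split; [exact: subset_trans MN|move=> NL; apply: nNM; exact: subset_trans LM].
- move=> L M DL DM; have [[Ll _ _ _] [Ml _ _ _]] := (D_cut DL, D_cut DM).
  have [LM|nLM] := pselect (L `<=` M); have [ML|nML] := pselect (M `<=` L).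
  + by left; apply/seteqP.
  + by right; left.
  + by right; right.
  + by case: (lower_total Ll Ml).
- move=> L M DL DM [_ nML]; have [x [y [Mx My Lx Ly xy]]] := cut_gap (D_cut DL) (D_cut DM) nML.
  by have [N DN [Nx Ny]] := D_dense xy; exists N => //; split; [exact: (sep _ _ x)|exact: (sep _ _ y)].
- move=> L DL; have [Ll [x Lx] [y Ly] _] := D_cut DL; split.
    by have [z zx] := dh_lt dhT x; have [M DM [_ Mx]] := D_dense zx; exists M => //; exact: (sep _ _ x).
  by have [z yz] := dh_gt dhT y; have [M DM [My _]] := D_dense yz; exists M => //; exact: (sep _ _ y).
- by have [_ _ [x [y xy]]] := dhT; have [L DL _] := D_dense xy; exists L.
Qed.

(** Cantor's theorem indexes [D] by the rationals, and a point goes to the supremum of the indices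
    whose cut omits it. Non-principality keeps that value irrational; completeness, applied to the
    union of the cuts with index below an irrational [r], gives surjectivity. *)
Lemma irrational_chain : order_isomorphic T (irrationals R).
Proof.
have [psi [idx [psiK idxK psi_lt]]] := cantor_iso rat_dlo D_dlo.
have psiD q : D (psi q) by case: (psiK q).
have psi_mono p q : p <= q -> psi p `<=` psi q.
  rewrite le_eqVlt => /orP[/eqP->//|pq].
  by case: (psi_lt p q I I pq).
have psi_dense x y : x < y -> exists2 q, psi q x & ~ psi q y.
  by move=> xy; have [L DL [Lx Ly]] := D_dense xy; have [_ E] := idxK L DL; exists (idx L); rewrite E.
have psi_sep p q x : psi q x -> ~ psi p x -> p < q.
  by move=> qx px; rewrite ltNge; apply/negP => /psi_mono/(_ x qx).
pose S x : set R := [set r | exists2 q, r = ratr q & ~ psi q x].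
have Sub x q : psi q x -> ubound (S x) (ratr q).
  by move=> qx r [p -> px]; rewrite ler_rat ltW //; exact: psi_sep qx px.
have Shas x : has_sup (S x).
  split.
    by have [y yx] := dh_lt dhT x; have [q _ qx] := psi_dense _ _ yx; exists (ratr q), q.
  by have [y xy] := dh_gt dhT x; have [q qx _] := psi_dense _ _ xy; exists (ratr q); exact: Sub.
have Sle x q : ~ psi q x -> ratr q <= sup (S x).
  by move=> qx; apply: sup_upper_bound => //; exists q.
have Sge x q : psi q x -> sup (S x) <= ratr q.
  by move=> qx; apply: ge_sup; [case: (Shas x)|exact: Sub].
have Sirr x : irrational (sup (S x)).
  move=> [q _ qS]; have [qx|qx] := pselect (psi q x).
    have [_ _ _ /(_ x qx)[y qy xy]] := D_cut (psiD q).
    have [p px py] := psi_dense _ _ xy; have := Sge x p px.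
    by rewrite -qS ler_rat leNgt (psi_sep p q y).
  have [Ll _ _ _] := D_cut (psiD q).
  (* If [x] were the least point off [psi q], then [psi q] would be the principal cut at [x]. *)
  have [y yx qy] : exists2 y, y < x & ~ psi q y.
    apply: contrapT => H; apply: (D_nonprincipal (x := x) (psiD q)).
    apply/seteqP; split=> y; first by move=> qy; exact: (lower_lt Ll).
    by move=> yx; apply: contrapT => qy; apply: H; exists y.
  have [p py px] := psi_dense _ _ yx; have := Sle x p px.
  by rewrite -qS ler_rat leNgt (psi_sep q p y).
have Slts x y : x < y -> sup (S x) < sup (S y).
  move=> xy; have [q qx qy] := psi_dense _ _ xy.
  apply: lt_le_trans (Sle y q qy); rewrite lt_neqAle Sge // andbT.
  by apply/eqP => E; apply: (Sirr x); exists q.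
have Ssurj r : irrational r -> exists x, sup (S x) = r.
  move=> ir; have neq q : ratr q <> r by move=> E; apply: ir; exists q.
  pose E : set T := fun x => exists2 q, ratr q < r & psi q x.
  have below s : s < r -> exists2 q, s < ratr q & ratr q < r.
    by move=> /rat_in_itvoo[q]; rewrite in_itv /= => /andP[]; exists q.
  have above s : r < s -> exists2 q, r < ratr q & ratr q < s.
    by move=> /rat_in_itvoo[q]; rewrite in_itv /= => /andP[]; exists q.
  have Esub q : r < ratr q -> E `<=` psi q.
    by move=> rq x [p pr]; apply: psi_mono; rewrite -(ler_rat R) ltW // (lt_trans pr).
  have cE : cut E.
    split.
    - move=> x y [q qr qy] xy; exists q => //.
      by have [l _ _ _] := D_cut (psiD q); exact: l qy xy.
    - have [|q _ qr] := below (r - 1)%R; first by rewrite Num.Theory.ltrBlDr Num.Theory.ltrDl.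
      by have [_ [x qx] _ _] := D_cut (psiD q); exists x, q.
    - have [|q rq _] := above (r + 1)%R; first by rewrite Num.Theory.ltrDl.
      by have [_ _ [x qx] _] := D_cut (psiD q); exists x => /(Esub q rq).
    - move=> x [q qr qx]; have [_ _ _ /(_ x qx)[y qy xy]] := D_cut (psiD q).
      by exists y => //; exists q.
  have nDE : ~ D E.
    move=> /idxK[_ EI]; have [lt|gt|/neq//] := ltgtP (ratr (idx E)) r.
      have [q]:= below _ lt; rewrite ltr_rat => /(psi_lt _ _ I I)[_ + qr]; apply.
      by rewrite EI => x qx; exists q.
    have [q rq] := above _ gt; rewrite ltr_rat => /(psi_lt _ _ I I)[_]; apply.
    by rewrite EI; exact: Esub.
  have [x Ex] := D_complete cE nDE; exists x.
  have xE q : ratr q < r -> ~ psi q x.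
    by move=> qr qx; have : E x; [exists q|rewrite Ex /= ltxx].
  apply: le_anti; apply/andP; split; last first.
    rewrite leNgt; apply/negP => /below[q Sq /xE/Sle].
    by rewrite leNgt Sq.
  apply: ge_sup; first by case: (Shas x).
  move=> _ [q -> qx]; rewrite leNgt; apply/negP => /above[p rp].
  rewrite ltr_rat => /(psi_lt _ _ I I)[_]; apply => y qy.
  apply: (Esub _ rp); rewrite Ex /=; have [l _ _ _] := D_cut (psiD q).
  exact: (lower_lt l).
pose F x : irrationals R := SigSub (mem_set (Sirr x)).
have Fval x : \val (F x) = sup (S x) by [].
have [G GK] : {G : irrationals R -> T | cancel G F}.
  apply/cid; suff /choice[G ?] : forall i : irrationals R, exists x, F x = i by exists G.
  move=> i; have [x xi] := Ssurj _ (set_mem (valP i)).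
  by exists x; apply: val_inj; rewrite Fval.
exists F; last by apply: ltW_homo => x y xy; rewrite lt_neqAle irrationals_leE !Fval
  ltW ?Slts // andbT -(inj_eq val_inj) !Fval lt_eqF // Slts.
exists G => // x; apply: contrapT => /eqP; rewrite neq_lt.
by move=> /orP[] /Slts; rewrite -!Fval GK ltxx.
Qed.

End IrrationalChain.

(** * The sentence as a property of groups, and its consequences *)

Section RationalLike.
Variable G : groupType.
Implicit Types f g h k n p s : G.

(** With [L] the cut of [(n, p)], every image [h L] has the form [k s L], where [s] and [k] come
    from the bicommutants of [f] and [g]. *)
Definition coverable n p f g := forall h, exists s k,
  bicommutes f s /\ bicommutes g k /\ side_stab n p (h^-1 * k * s).

Definition two_orbits n p := forall n1 p1 n2 p2, half_line n1 p1 -> half_line n2 p2 ->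
  same_orbit n p n1 p1 \/ same_orbit n p n2 p2 \/ same_orbit n1 p1 n2 p2.

Definition rational_like := overlapping G /\ has_reversed G /\
  exists n p f g, half_line n p /\ coverable n p f g /\ two_orbits n p.

End RationalLike.

Section RationalLikeChain.
Context {d : Order.disp_t} {T : orderType d}.
Implicit Types (f g h k n p s : oaut T) (x y z : T) (L M : set T).

Theorem rational_like_chain (R : realType) : oaut_transitive T -> rational_like (oaut T) ->
  order_isomorphic T rat \/ order_isomorphic T (irrationals R).
Proof.
move=> tr [ov [rev [n [p [f [g [np [cov two]]]]]]]].
have dhT : doubly_homogeneous (T := T).
  split=> //; first exact: bitransitiveP.
  have [_ [/aut_up[x [xp|xp]] _]] := np; [by exists x, (p x)|by exists x, (p^-1 x)].
have [L cL sL] := half_line_cut dhT np.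
have bL : boundary n p L by [].
pose w (i j : int) := zpow g j * zpow f i.
have orbit h : exists i j, act h L = act (w i j) L.
  have [s [k [fs [gk /sL E]]]] := cov h.
  have [i Ei] := bicommutes_orbit dhT cL fs.
  have [j Ej] := bicommutes_orbit dhT (act_cut (zpow f i) cL) gk.
  by exists i, j; rewrite -{1}E -!actM !mulgA mulgV mul1g actM Ei Ej.
pose u (m : nat) := if unpickle m is Some (i, j) then w i j else 1.
have uP h : exists m, act (u m) L = act h L.
  by have [i [j ->]] := orbit h; exists (pickle (i, j)); rewrite /u pickleK.
have dense x y : x < y -> exists h, act h L x /\ ~ act h L y.
  move=> xy; have [Ll [a La] [b Lb] _] := cL; have [_ bt _] := dhT.
  have [h [<- <-]] := bt a b x y (lower_lt Ll La Lb) xy.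
  by exists h; rewrite !act_aut.
(* The orbit of [L] is countable and separates points, so picking a point of [M] outside each
   translate of [L] that does not contain [M] gives a cofinal sequence of [M]. *)
have gens M : cut M -> exists n1 p1, half_line n1 p1 /\ boundary n1 p1 M.
  move=> cM; have [Ml [b Mb] _ Mm] := cM.
  have pick m : exists x, M x /\ (~ act (u m) L x \/ M `<=` act (u m) L).
    have [ML|nML] := pselect (M `<=` act (u m) L); first by exists b; split=> //; right.
    by have [x Mx Lx] := not_sub nML; exists x; split=> //; left.
  have [a aP] := choice pick.
  apply: (cut_generators dhT cM (a := a)) => [m|x Mx]; first by case: (aP m).
  have [y My xy] := Mm _ Mx; have [h [hx hy]] := dense _ _ xy.
  have [m mh] := uP h; exists m; rewrite -mh in hx hy.
  have [_ [am|/(_ _ My)//]] := aP m.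
  by have [l _ _ _] := act_cut (u m) cL; apply: ltW; exact: lower_lt am.
have [[x0 Lx0]|npr] := pselect (exists x, L = [set y | y < x]).
  left; apply: countable_iso rat_dlo; apply: dh_dlo => //.
  exists (fun m => u m x0) => x; have [h hx] := tr x0 x; have [m] := uP h.
  rewrite Lx0 !act_principal hx => E; exists m.
  have [xu|xu|//] := ltgtP (u m x0) x.
    by have : [set y | y < x] (u m x0) by []; rewrite -E /= ltxx.
  by have : [set y | y < u m x0] x by []; rewrite E /= ltxx.
right; apply: (@irrational_chain R _ _ dhT [set M | exists h, act h L = M]).
- by move=> M [h <-]; exact: act_cut.
- move=> M x [h <-] E; apply: npr; exists (h^-1 x).
  by rewrite -act_principal -E actK.
- by move=> x y /dense[h [hx hy]]; exists (act h L) => //; exists h.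
- move=> M cM nM; have [_ _ [a b]] := dhT.
  have [n1 [p1 [h1 b1]]] := gens M cM.
  have [n2 [p2 [h2 b2]]] := gens _ (principal_cut dhT a).
  (* Neither [M] nor the principal cut at [a] lies in the orbit of [L], so they lie in one orbit and
     [M] is principal. *)
  have [|[|]] := two n1 p1 n2 p2 h1 h2.
  + by move=> /(boundary_same_orbit dhT bL b1).
  + move=> /(boundary_same_orbit dhT bL b2)[h hL]; case: npr; exists (h^-1 a).
    by rewrite -act_principal -hL actK.
  + move=> /(boundary_same_orbit dhT b1 b2)[h hM]; exists (h^-1 a).
    by rewrite -act_principal -hM actK.
- by exists (fun m => act (u m) L) => M [h <-]; exact: uP.
Qed.

End RationalLikeChain.

(** * The clauses in countable doubly homogeneous chains *)

Section CountableHomogeneous.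
Context {d : Order.disp_t} {T : orderType d}.
Implicit Types (f g h k n p s : oaut T) (x y z : T) (L M : set T).
Hypothesis dhT : doubly_homogeneous (T := T).

(* The conjugate [cj y a] is chosen to agree with [a] at one point of an
   [a]-orbit but not at the next, and likewise for a conjugate [b] of [a]. *)
Lemma dh_overlapping : overlapping (oaut T).
Proof.
have inv (a b a' b' : oaut T) : a' = a \/ a' = a^-1 -> b' = b \/ b' = b^-1 ->
    commute a b -> commute a' b'.
  have V (c e : oaut T) : commute c e -> commute c^-1 e.
    by move=> /commute_sym/commuteV/commute_sym.
  by move=> [->|->] [->|->] ab; do ?apply: V; do ?apply: commuteV.
have key (a b c : oaut T) x y z : z < c z -> x < a x -> a x < y -> y < b y ->
    exists u, ~ commute a (cj u c) /\ ~ commute b (cj u c).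
  move=> zc xa ay yb.
  have [v [axs sy va]] : exists v, [/\ a x < v, v < y & v <> a (a x)].
    have [v1 as1 s1y] := dh_dense dhT ay; have [v2 as2 s21] := dh_dense dhT as1.
    have [E|] := pselect (v1 = a (a x)); last by exists v1.
    by exists v2; split=> //; [exact: lt_trans s1y|rewrite -E => E2; rewrite E2 ltxx in s21].
  have [v' bys' vb] : exists2 v', b y < v' & v' <> b (b y).
    have [v1 bs1] := dh_gt dhT (b y); have [v2 s12] := dh_gt dhT v1.
    have [E|] := pselect (v1 = b (b y)); last by exists v1.
    by exists v2; [exact: lt_trans s12|rewrite -E => E2; rewrite E2 ltxx in s12].
  have [t tz] := dh_lt dhT (Order.min z x); move: tz; rewrite lt_min => /andP[tz tx].
  have cc : c z < c (c z) by rewrite aut_lt.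
  have ccc : c (c z) < c (c (c z)) by rewrite aut_lt.
  have [||//|u _ [u0 u1 u2 u3 u4 u5]] := @shift_seq _ _ dhT t
      [:: z; c z; c (c z); c (c (c z)); c (c (c (c z))); c (c (c (c (c z))))]
      [:: x; a x; v; y; b y; v'].
  - by rewrite /= tz zc cc ccc !aut_lt zc.
  - by rewrite /= tx xa axs sy yb bys'.
  exists u; split=> /commute_fun.
    by move=> /(_ x); rewrite !cjE -{1}u0 autK u1 -[in RHS]u1 autK u2 => /esym/va.
  by move=> /(_ y); rewrite !cjE -{1}u3 autK u4 -[in RHS]u4 autK u5 => /esym/vb.
have two (a b c : oaut T) x y z : z < c z -> x < a x -> y < b y ->
    exists u, ~ commute a (cj u c) /\ ~ commute b (cj u c).
  move=> zc xa yb; have [ay|yax] := ltP (a x) y; first exact: key zc xa ay yb.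
  have H x' : x' < a x' -> b y < x' -> exists u, ~ commute a (cj u c) /\ ~ commute b (cj u c).
    by move=> xa' by'; have [u [ub ua]] := key b a c y x' z zc yb by' xa'; exists u.
  have [|aby] := ltP (b y) (a (a x)); first by apply: H; rewrite !aut_lt.
  apply: (key a b c x (b y) z) => //; last by rewrite aut_lt.
  by apply: lt_le_trans aby; rewrite aut_lt.
move=> a x a1.
have up (b : oaut T) : b <> 1 -> exists2 c : oaut T, c = b \/ c = b^-1 & exists y, y < c y.
  by move=> /aut_up[y [yb|yb]]; [exists b; [left|exists y]|exists b^-1; [right|exists y]].
have xa1 : cj x a <> 1 by move=> E; apply: a1; rewrite -(cjK x^-1 a) invgK E /cj mulg1 mulgV.
have [c ca [z zc]] := up _ a1; have [b bx [y yb]] := up _ xa1.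
have [u [uc ub]] := two c b c z y z zc zc yb; exists u.
have cac : cj u c = cj u a \/ cj u c = (cj u a)^-1.
  by case: ca => ->; [left|right; rewrite cjV].
by split; [move=> /(inv _ _ c (cj u c) ca cac)|move=> /(inv _ _ b (cj u c) bx cac)].
Qed.

(** Both sides of a non-principal cut of a countable chain are dense without endpoints, so Cantor's
    theorem matches the two cuts side by side. *)
Lemma nonprincipal_conj L M : (exists u : nat -> T, forall x, exists i, u i = x) ->
  cut L -> cut M -> ~ (exists x, L = [set y | y < x]) -> ~ (exists x, M = [set y | y < x]) ->
  exists h, act h L = M.
Proof.
move=> [e eT] cL cM nL nM.
have lower_dlo N : cut N -> countable_dlo (fun x y : T => x < y) N.
  move=> [Nl [a Na] _ Nm]; apply: order_dlo.
  - move=> x y Nx Ny /(dh_dense dhT)[z xz zy]; exists z => //.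
    exact: Nl Ny (ltW zy).
  - move=> x Nx; split; last by have [y Ny xy] := Nm x Nx; exists y.
    by have [y yx] := dh_lt dhT x; exists y => //; exact: Nl Nx (ltW yx).
  - by exists a.
  - by exists e => x _.
have upper_dlo N : cut N -> ~ (exists x, N = [set y | y < x]) ->
    countable_dlo (fun x y : T => x < y) (~` N).
  move=> [Nl _ [a Na] _] npr; apply: order_dlo.
  - move=> x y Nx Ny /(dh_dense dhT)[z xz zy]; exists z => //.
    by move=> Nz; apply: Nx; exact: Nl Nz (ltW xz).
  - move=> x Nx; split.
      apply: contrapT => H; apply: npr; exists x; apply/seteqP; split=> y.
        by move=> Ny; exact: (lower_lt Nl).
      by move=> yx; apply: contrapT => Ny; apply: H; exists y.
    have [y xy] := dh_gt dhT x; exists y => // Ny; apply: Nx; exact: Nl Ny (ltW xy).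
  - by exists a.
  - by exists e => x _.
have [F [G [FM GL Flt]]] := cantor_iso (lower_dlo L cL) (lower_dlo M cM).
have [F' [G' [FM' GL' Flt']]] := cantor_iso (upper_dlo L cL nL) (upper_dlo M cM nM).
pose h x := if pselect (L x) then F x else F' x.
pose k x := if pselect (M x) then G x else G' x.
have hL x : L x -> h x = F x by rewrite /h; case: pselect.
have hU x : ~ L x -> h x = F' x by rewrite /h; case: pselect.
have kM x : M x -> k x = G x by rewrite /k; case: pselect.
have kU x : ~ M x -> k x = G' x by rewrite /k; case: pselect.
have hM x : M (h x) <-> L x.
  have [Lx|Lx] := pselect (L x); first by rewrite hL //; case: (FM x Lx).
  by rewrite hU //; case: (FM' x Lx).
have hk : cancel h k.
  move=> x; have [Lx|Lx] := pselect (L x); have := Lx; rewrite -hM => hx.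
    by rewrite kM // hL //; case: (FM x Lx).
  by rewrite kU // hU //; case: (FM' x Lx).
have kL x : L (k x) <-> M x.
  have [Mx|Mx] := pselect (M x); first by rewrite kM //; case: (GL x Mx).
  by rewrite kU //; case: (GL' x Mx).
have kh : cancel k h.
  move=> x; have [Mx|Mx] := pselect (M x); have := Mx; rewrite -kL => kx.
    by rewrite hL // kM //; case: (GL x Mx).
  by rewrite hU // kU //; case: (GL' x Mx).
have [[Ll _ _ _] [Ml _ _ _]] := (cL, cM).
have hom : {homo h : x y / x <= y}.
  apply: ltW_homo => x y xy.
  have [Lx|Lx] := pselect (L x); have [Ly|Ly] := pselect (L y).
  - by rewrite !hL //; exact: Flt.
  - by apply: (lower_lt Ml); rewrite hM.
  - by case: Lx; exact: Ll Ly (ltW xy).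
  - by rewrite !hU //; exact: Flt'.
have [g gh] := oaut_of_bij (Bijective hk kh) hom; exists g.
apply/seteqP; split=> x; rewrite /act.
  by rewrite -{2}(autVK g x) gh hM.
by rewrite -{1}(autVK g x) gh hM.
Qed.

Lemma countable_gens L : (exists u : nat -> T, forall x, exists i, u i = x) -> cut L ->
  exists n p, half_line n p /\ boundary n p L.
Proof.
move=> [u uT] cL; have [_ [b Lb] _ _] := cL.
apply: (cut_generators dhT cL (a := fun i => if pselect (L (u i)) then u i else b)).
  by move=> i; case: pselect.
by move=> x Lx; have [i ui] := uT x; exists i; rewrite ui; case: pselect.
Qed.

(** The pair is taken at the cut of [r], and covering holds with actual powers of [f] and [g].
    Principal cuts are conjugate by transitivity, the others by [nonprincipal_conj]. *)
Lemma dh_rational_like (f g : oaut T) r : (exists u : nat -> T, forall x, exists i, u i = x) ->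
  has_reversed (oaut T) -> (forall x, exists i j, x = zpow g j (zpow f i r)) ->
  rational_like (oaut T).
Proof.
move=> cT rev fg; split; [exact: dh_overlapping|split=> //].
have [n [p [np bL]]] := countable_gens cT (principal_cut dhT r).
exists n, p, f, g; split=> //; split=> [h|n1 p1 n2 p2 h1 h2].
  have [i [j hr]] := fg (h r); exists (zpow f i), (zpow g j).
  split; first exact: bicommutes_zpow; split; first exact: bicommutes_zpow.
  have [_ ->] := bL; rewrite act_principal.
  by change ([set y | y < h^-1 (zpow g j (zpow f i r))] = [set y | y < r]); rewrite -hr autK.
have [L cL sL] := half_line_cut dhT h1; have [M cM sM] := half_line_cut dhT h2.
have [tr _ _] := dhT.
have [[a La]|nL] := pselect (exists x, L = [set y | y < x]).
  left; apply/(boundary_same_orbit dhT bL (L := _) (M := L)) => //.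
  by have [h hra] := tr r a; exists h; rewrite act_principal hra La.
have [[a Ma]|nM] := pselect (exists x, M = [set y | y < x]).
  right; left; apply/(boundary_same_orbit dhT bL (M := M)) => //.
  by have [h hra] := tr r a; exists h; rewrite act_principal hra Ma.
right; right; apply/(boundary_same_orbit dhT (L := L) (M := M)) => //.
exact: nonprincipal_conj.
Qed.

End CountableHomogeneous.

(** * The clauses in the rationals, by transport from convenient copies *)

Section TransportedAutomorphisms.
Context {d : Order.disp_t} {T : orderType d}.
Variables (S : eqType) (lt : S -> S -> Prop) (X : set S) (F : T -> S) (G : S -> T).
Hypothesis dX : countable_dlo lt X.
Hypothesis FG : forall x, X (F x) /\ G (F x) = x.
Hypothesis GF : forall s, X s -> F (G s) = s.
Hypothesis F_lt : forall x y, x < y -> lt (F x) (F y).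

Lemma transport_aut (h k : S -> S) :
  (forall s, X s -> X (h s) /\ k (h s) = s) -> (forall s, X s -> X (k s) /\ h (k s) = s) ->
  (forall s t, X s -> X t -> lt s t -> lt (h s) (h t)) ->
  exists g : oaut T, forall x, F (g x) = h (F x).
Proof.
move=> hk kh hlt; have [[ir tr] _ _ _ _] := dX.
pose g x := G (h (F x)); pose g' x := G (k (F x)).
have XF x : X (F x) by case: (FG x).
have gE x : F (g x) = h (F x) by rewrite GF //; case: (hk _ (XF x)).
have g'E x : F (g' x) = k (F x) by rewrite GF //; case: (kh _ (XF x)).
have K1 : cancel g g'.
  by move=> x; rewrite /g' gE; have [_ ->] := hk _ (XF x); case: (FG x).
have K2 : cancel g' g.
  by move=> x; rewrite /g g'E; have [_ ->] := kh _ (XF x); case: (FG x).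
have hom : {homo g : x y / x <= y}.
  apply: ltW_homo => x y xy.
  have H : lt (F (g x)) (F (g y)) by rewrite !gE; apply: hlt => //; exact: F_lt.
  rewrite ltNge le_eqVlt; apply/negP => /orP[/eqP E|/F_lt H'].
    by rewrite E in H; exact: ir H.
  exact: (ir _ (tr _ _ _ H H')).
by have [f fg] := oaut_of_bij (Bijective K1 K2) hom; exists f => x; rewrite fg.
Qed.

End TransportedAutomorphisms.

Section RationalChain.
Import GRing.Theory Num.Theory.
Local Open Scope ring_scope.

Lemma affine_aut (a b : rat) : 0 < a -> exists g : oaut rat, forall x, g x = a * x + b.
Proof.
move=> a0; have au : a \is a GRing.unit by rewrite unitfE gt_eqF.
have [||g gE] := @oaut_of_bij _ rat (fun x => a * x + b).
- by exists (fun x => a^-1 * (x - b)) => x; [rewrite addrK mulKr|rewrite mulVKr ?subrK].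
- by move=> x y xy; rewrite lerD2r ler_pM2l.
by exists g => x; rewrite gE.
Qed.

Lemma rat_dh : doubly_homogeneous (T := rat).
Proof.
split=> [a b|a b c e ab ce|]; last by exists 0, 1.
  by have [g gE] := affine_aut (b - a) ltr01; exists g; rewrite gE mul1r addrC subrK.
have k0 : 0 < (e - c) / (b - a) by rewrite divr_gt0 ?subr_gt0.
have [g gE] := affine_aut (c - (e - c) / (b - a) * a) k0; exists g; rewrite !gE; split.
  by rewrite addrC subrK.
rewrite addrCA -mulrBr divfK ?subr_eq0 ?gt_eqF //.
by rewrite addrC subrK.
Qed.

Lemma rat_countable : exists u : nat -> rat, forall x, exists i, u i = x.
Proof.
by exists (fun i => odflt 0 (unpickle i)) => x; exists (pickle x); rewrite pickleK.
Qed.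

(* On the lexicographic product of the integers and the rationals, shifting the
   first coordinate reverses the translation by [(-1) ^ m] of the [m]-th copy. *)
Lemma rat_has_reversed : has_reversed (oaut rat).
Proof.
pose lex (p q : int * rat) := p.1 < q.1 \/ p.1 = q.1 /\ p.2 < q.2.
have dlex : countable_dlo lex setT.
  split.
  - split=> [[m x] [|[_]] /=|[m x] [n y] [k z]]; rewrite ?ltxx //.
    move=> [/= mn|[/= -> xy]] [/= nk|[/= <- yz]]; [left|left|left|right] => //=.
      exact: lt_trans nk.
    by split=> //; exact: lt_trans yz.
  - move=> [m x] [n y] _ _; case: (ltgtP m n) => [mn|nm|->].
    + by right; left; left.
    + by right; right; left.
    + by case: (ltgtP x y) => [xy|yx|->]; [right; left; right|right; right; right|left].
  - move=> [m x] [n y] _ _ [/= mn|[/= <- xy]].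
      exists (m, x + 1) => //; split; last by left.
      by right; rewrite /= ltrDl.
    exists (m, (x + y) / 2) => //; have [xz zy] := midf_lt xy.
    by split; right.
  - move=> [m x] _; split; [exists (m, x - 1) => //|exists (m, x + 1) => //].
      by right; rewrite /= ltrBlDr ltrDl.
    by right; rewrite /= ltrDl.
  - exists (0, 0) => //; exists (fun n => odflt (0, 0) (unpickle n)) => x _.
    by exists (pickle x); rewrite pickleK.
have [F [G [FG GF Flt]]] := cantor_iso rat_dlo dlex.
have [{}FG {}GF {}Flt] : [/\ forall x, setT (F x) /\ G (F x) = x,
    forall s, setT s -> F (G s) = s & forall x y : rat, x < y -> lex (F x) (F y)].
  by split=> [x|s _|x y]; [exact: FG|case: (GF s)|exact: Flt].
pose c (m : int) : rat := (-1) ^ m.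
have cS m : c (m + 1) = - c m by rewrite /c exprzDr ?unitrN1 // expr1z mulrN1.
have [|||t tE] := transport_aut dlex FG GF Flt (h := fun p => (p.1 + 1, p.2))
    (k := fun p => (p.1 - 1, p.2)).
- by move=> [m x] _; rewrite /= addrK.
- by move=> [m x] _; rewrite /= subrK.
- by move=> [m x] [n y] _ _ [/= mn|[/= -> xy]]; [left; rewrite /= ltrD2r|right].
have [|||h hE] := transport_aut dlex FG GF Flt (h := fun p => (p.1, p.2 + c p.1))
    (k := fun p => (p.1, p.2 - c p.1)).
- by move=> [m x] _; rewrite /= addrK.
- by move=> [m x] _; rewrite /= subrK.
- by move=> [m x] [n y] _ _ [/= mn|[/= -> xy]]; [left|right; rewrite /= ltrD2r].
exists h, t; split.
  move=> h1; have := hE 0; rewrite h1 => /(congr1 snd)/eqP /=.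
  by rewrite -{1}[(F 0).2]addr0 (inj_eq (addrI _)) eq_sym expfz_eq0 oppr_eq0 oner_eq0 andbF.
have E : (h * t * h)%g = t.
  apply: oaut_eq => x; have Finj : injective F by apply: (@can_inj _ _ _ G) => y; case: (FG y).
  apply: Finj; change (F (h (t (h x))) = F (t x)).
  by rewrite hE !tE hE /= cS -addrA subrr addr0.
by apply: (mulgI h); rewrite /cj !mulgA E !mulgV.
Qed.

(* The two automorphisms are [x + 1] and [2 x] on the dyadic rationals, a copy of
   the rationals. *)
Lemma rat_two_generated : exists (f g : oaut rat) r,
  forall x, exists i j, x = zpow g j (zpow f i r).
Proof.
have two0 : (2 : rat) != 0 by [].
pose dyadic (s : rat) := exists (m : int) (n : nat), s = m%:~R / 2 ^+ n.
have dyadicI (m : int) : dyadic m%:~R by exists m, 0%N; rewrite expr0 divr1.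
have dyadicD s t : dyadic s -> dyadic t -> dyadic (s + t).
  move=> [m [n ->]] [k [l ->]]; exists (m * 2 ^+ l + k * 2 ^+ n), (n + l)%N.
  by rewrite exprD addf_div ?expf_neq0 // intrD !intrM !rmorphXn.
have dyadic2 s : dyadic s -> dyadic (s / 2).
  by move=> [m [n ->]]; exists m, n.+1; rewrite exprSr invfM mulrA.
have dyadicM s : dyadic s -> dyadic (2 * s).
  by move=> ds; rewrite mulr_natl mulr2n; exact: dyadicD.
have dyadic0 : dyadic 0 by exact: (dyadicI 0).
have dD : countable_dlo (fun x y : rat => x < y) dyadic.
  apply: order_dlo => [x y dx dy /midf_lt[xz zy]|x dx||].
  - by exists ((x + y) / 2) => //; apply: dyadic2; exact: dyadicD.
  - split; [exists (x + (-1)%:~R)|exists (x + 1%:~R)]; try by apply: dyadicD.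
      by rewrite -ltrBrDl subrr.
    by rewrite ltrDl.
  - by exists 0.
  - by have [u uE] := rat_countable; exists u => x _.
have [F [G [FG GF Flt]]] := cantor_iso rat_dlo dD.
have [{}FG {}GF {}Flt] : [/\ forall x, dyadic (F x) /\ G (F x) = x,
    forall s, dyadic s -> F (G s) = s & forall x y : rat, x < y -> F x < F y].
  by split=> [x|s ds|x y]; [exact: FG|case: (GF s ds)|exact: Flt].
have [|||f fE] := transport_aut dD FG GF Flt (h := fun s => s + 1) (k := fun s => s - 1).
- by move=> s ds; rewrite addrK; split=> //; apply: dyadicD => //; exact: (dyadicI 1).
- by move=> s ds; rewrite subrK; split=> //; apply: dyadicD => //; exact: (dyadicI (-1)).
- by move=> s t _ _; rewrite ltrD2r.
have [|||g gE] := transport_aut dD FG GF Flt (h := fun s => 2 * s) (k := fun s => s / 2).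
- by move=> s ds; split; [exact: dyadicM|rewrite mulrC mulKf].
- by move=> s ds; split; [exact: dyadic2|rewrite mulrC divfK].
- by move=> s t _ _; rewrite ltr_pM2l.
have Finj : injective F by apply: (@can_inj _ _ _ G) => y; case: (FG y).
exists f, g, (G 0).
have fi i : F (zpow f i (G 0)) = i%:~R.
  have fS j : F (zpow f (j + 1) (G 0)) = F (zpow f j (G 0)) + 1.
    by rewrite zpowS -fE.
  elim/int_rec: i => [|n IH|n IH].
  - by rewrite /= GF.
  - by rewrite -addn1 PoszD fS IH intrD.
  - apply: (@addIr _ 1); rewrite -fS -addn1 PoszD opprD addrNK IH.
    by rewrite intrD subrK.
have gn n x : F ((g ^+ n)%g x) = 2 ^+ n * F x.
  elim: n => [|n IH]; first by rewrite expr0 mul1r.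
  by rewrite expgS; change (F (g ((g ^+ n)%g x)) = 2 ^+ n.+1 * F x); rewrite gE IH exprS mulrA.
(* With [F x = m / 2 ^ n], the point is reached from [G 0] by [m] translations and then [n]
   halvings, that is, by [g] to the power [-n]. *)
move=> x; have [[m [n Fx]] _] := FG x; exists m, (- n%:Z).
rewrite -zpowV /= expVgn; apply: (@aut_inj _ _ (g ^+ n)%g); rewrite autVK.
by apply: Finj; rewrite gn fi Fx mulrC divfK // expf_neq0.
Qed.

Theorem rat_rational_like : rational_like (oaut rat).
Proof.
have [f [g [r fgr]]] := rat_two_generated.
exact: (dh_rational_like rat_dh rat_countable rat_has_reversed fgr).
Qed.

End RationalChain.

(* Each formula takes the terms it speaks about and the first index [i] not
   occurring in them; its bound variables are numbered from [i] on. *)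
Definition fcomm (s t : gterm) := GEq (GMul s t) (GMul t s).
Definition fcj (s t : gterm) := GMul (GMul s t) (GInv s).
Definition fneq1 (t : gterm) := GNot (GEq t GOne).
Definition fiff (p q : gformula) := GAnd (GImp p q) (GImp q p).

Definition foverlapping := GForall 0 (GForall 1 (GImp (fneq1 (GVar 0)) (GExists 2 (GAnd
  (GNot (fcomm (GVar 0) (fcj (GVar 2) (GVar 0))))
  (GNot (fcomm (fcj (GVar 1) (GVar 0)) (fcj (GVar 2) (GVar 0)))))))).

Definition freversed :=
  GExists 0 (GExists 1 (GAnd (fneq1 (GVar 0)) (GEq (fcj (GVar 1) (GVar 0)) (GInv (GVar 0))))).

Definition fside i (n p x : gterm) :=
  GForall i (GImp (fcomm (GVar i) n) (fcomm x (fcj (GVar i) p))).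

Definition fside_stab i (n p h : gterm) := GForall i
  (fiff (fside i.+1 n p (GVar i)) (fside i.+1 n p (fcj h (GVar i)))).

Definition fhalf_line i (n p : gterm) :=
  GAnd (GExists i (GAnd (fneq1 (GVar i)) (fside i.+1 n p (GVar i))))
  (GAnd (fneq1 p) (GForall i (GOr
    (GForall i.+1 (GImp (fside i.+2 n p (GVar i.+1)) (fside i.+2 n p (fcj (GVar i) (GVar i.+1)))))
    (GForall i.+1 (GImp (fside i.+2 n p (fcj (GVar i) (GVar i.+1))) (fside i.+2 n p (GVar i.+1))))))).

Definition fbicommutes i (f s : gterm) :=
  GForall i (GImp (fcomm (GVar i) f) (fcomm (GVar i) s)).

Definition fcoverable i (n p f g : gterm) := GForall i (GExists i.+1 (GExists i.+2
  (GAnd (fbicommutes i.+3 f (GVar i.+1)) (GAnd (fbicommutes i.+3 g (GVar i.+2))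
    (fside_stab i.+3 n p (GMul (GMul (GInv (GVar i)) (GVar i.+2)) (GVar i.+1))))))).

Definition fsame_orbit i (n p n1 p1 : gterm) := GExists i (GForall i.+1
  (fiff (fside_stab i.+2 n p (GVar i.+1)) (fside_stab i.+2 n1 p1 (fcj (GVar i) (GVar i.+1))))).

Definition ftwo_orbits i (n p : gterm) :=
  GForall i (GForall i.+1 (GForall i.+2 (GForall i.+3
    (GImp (fhalf_line i.+4 (GVar i) (GVar i.+1)) (GImp (fhalf_line i.+4 (GVar i.+2) (GVar i.+3))
      (GOr (fsame_orbit i.+4 n p (GVar i) (GVar i.+1))
        (GOr (fsame_orbit i.+4 n p (GVar i.+2) (GVar i.+3))
          (fsame_orbit i.+4 (GVar i) (GVar i.+1) (GVar i.+2) (GVar i.+3))))))))).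

Definition frational_like := GAnd foverlapping (GAnd freversed
  (GExists 0 (GExists 1 (GExists 2 (GExists 3
    (GAnd (fhalf_line 4 (GVar 0) (GVar 1))
      (GAnd (fcoverable 4 (GVar 0) (GVar 1) (GVar 2) (GVar 3))
        (ftwo_orbits 4 (GVar 0) (GVar 1))))))))).

Lemma frational_like_sentence : gsentence frational_like.
(* No variable index exceeds 11, so after fourteen case distinctions the remaining indices match no
   variable. *)
Proof. by move=> i; do 14! (case: i => [//|i]). Qed.

(** The formulas mirror the definitions connective by connective, so both sides are convertible. *)
Lemma gsat_rational_like (G : groupType) : gsat G frational_like = rational_like G.
Proof. by []. Qed.

Theorem theorem2 (R : realType) (d : Order.disp_t) (Omega : orderType d) :
  oaut_transitive Omega ->
  elem_equiv (oaut Omega) (oaut rat) ->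
  order_isomorphic Omega rat \/ order_isomorphic Omega (irrationals R).
Proof.
move=> tr equiv; apply: (rational_like_chain R tr); rewrite -gsat_rational_like.
by apply/(equiv _ frational_like_sentence); rewrite gsat_rational_like; exact: rat_rational_like.
Qed.
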